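(* Let $\alpha\in(0,1)$. Assume that $(X_i,\mathcal{F}_i)_{i\ge1}$ is a sequence of supermartingale differences; let $S_k=\sum_{i=1}^kX_i$ and $\langle S\rangle_k=\sum_{i=1}^kE(X_i^2|\mathcal{F}_{i-1})$. Assume that there are constants $C_1,C_2\in(0,\infty)$ such that $$E\exp\{(X_i^+)^{\frac{\alpha}{1-\alpha}}\}\le C_1\ \text{ for all } i\ge1\qquad\text{and}\qquad E\exp\Big\{\Big(\frac{\langle S\rangle_n}{n}\Big)^{\frac{\alpha}{1-\alpha}}\Big\}\le C_2\ \text{ for all } n\ge1.$$ Then, for all $x>0$ and all integers $n\ge1$, $$P\Big(\max_{1\le k\le n}S_k\ge nx\Big)\le\exp\left\{-\frac{x^{1+\alpha}}{2\left(1+\frac13x\right)}n^{\alpha}\right\}+(nC_1+C_2)\exp\{-x^{\alpha}n^{\alpha}\}.$$ In particular, with $x=1$, $$P\Big(\max_{1\le k\le n}S_k\ge n\Big)=O\big(\exp\{-C\,n^{\alpha}\}\big),\qquad n\to\infty,$$ where $C>0$ is an absolute constant. Moreover, the power $\alpha$ in the last bound is optimal even for the class of stationary martingale differences, in the following sense: for each $\alpha\in(0,1)$, there exists a stationary sequence of martingale differences $(\widehat{X}_i,\mathcal{F}_i)_{i\ge1}$ satisfying $E\exp\{|\widehat{X}_1|^{\frac{2\alpha}{1-\alpha}}\}<\infty$ and, with $\widehat{S}_k=\sum_{i=1}^k\widehat{X}_i$, $$P\Big(\max_{1\le k\le n}\widehat{S}_k\ge n\Big)\ge\exp\{-3n^{\alpha}\}$$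 for all $n$ large enough.
   Context: A sequence of supermartingale differences (resp. martingale differences) $(X_i,\mathcal{F}_i)_{i\ge1}$ is a sequence of integrable real random variables on a probability space with a filtration $\mathcal{F}_0\subseteq\mathcal{F}_1\subseteq\mathcal{F}_2\subseteq\cdots$ such that each $X_i$ is $\mathcal{F}_i$-measurable and $E(X_i|\mathcal{F}_{i-1})\le0$ (resp. $=0$) almost surely for all $i\ge1$; $\mathcal{F}_0$ is not required to be trivial. Notation: $X_i^+=\max\{X_i,0\}$. For two functions $f$ and $g$, $f(n)=O(g(n))$ means that there exists a constant $K>0$ such that $|f(n)|\le K|g(n)|$ for all $n\ge1$ (here $K$ may depend on $\alpha,C_1,C_2$, whereas the constant $C$ in the exponent is absolute). *)

(* Defs.v *)
From mathcomp Require Export all_boot all_order all_algebra.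
From mathcomp Require Export all_classical all_reals all_analysis.
From mathcomp Require Export measurable_realfun.

Set Implicit Arguments.
Unset Strict Implicit.
Unset Printing Implicit Defensive.

Export Order.TTheory GRing.Theory Num.Theory.
Export numFieldNormedType.Exports.

Local Open Scope classical_set_scope.
Local Open Scope ring_scope.
Local Open Scope ereal_scope.

Definition measurable_wrt d d' (T : measurableType d) (U : measurableType d')
    (G : set (set T)) (Y : T -> U) : Prop :=
  forall B : set U, measurable B -> G (Y @^-1` B).

Definition filtration d (T : measurableType d) (F : nat -> set (set T)) : Prop :=
  [/\ forall i, sigma_algebra [set: T] (F i),
      forall i, F i `<=` measurable
    & forall i, F i `<=` F i.+1].

(* Y is a version of E(X | G).  The definition is meant for X integrable or
   X >= 0; in the latter case X need not be integrable and the conditional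
   expectation is [0, +oo]-valued (up to a null set), which is why Y takes
   extended real values. *)
Definition is_cond_exp d (T : measurableType d) (R : realType)
    (P : probability T R) (G : set (set T)) (X Y : T -> \bar R) : Prop :=
  measurable_wrt G Y /\
  forall A, G A -> \int[P]_(w in A) Y w = \int[P]_(w in A) X w.

(* Sequences are indexed from 1: X 0 is never used. *)
Definition adapted_integrable d (T : measurableType d) (R : realType)
    (P : probability T R) (F : nat -> set (set T)) (X : nat -> T -> R) : Prop :=
  filtration F /\
  forall i, (1 <= i)%N ->
    P.-integrable [set: T] (EFin \o X i) /\
    measurable_wrt (F i) (X i).

Definition supermartingale_differences d (T : measurableType d) (R : realType)
    (P : probability T R) (F : nat -> set (set T)) (X : nat -> T -> R) : Prop :=
  adapted_integrable P F X /\
  forall i, (1 <= i)%N ->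
    exists2 Y : T -> \bar R, is_cond_exp P (F i.-1) (EFin \o X i) Y
                           & {ae P, forall w, Y w <= 0}.

Definition martingale_differences d (T : measurableType d) (R : realType)
    (P : probability T R) (F : nat -> set (set T)) (X : nat -> T -> R) : Prop :=
  adapted_integrable P F X /\
  forall i, (1 <= i)%N ->
    exists2 Y : T -> \bar R, is_cond_exp P (F i.-1) (EFin \o X i) Y
                           & {ae P, forall w, Y w = 0}.

Definition partial_sum (T : Type) (R : realType) (X : nat -> T -> R)
    (k : nat) (w : T) : R :=
  (\sum_(1 <= i < k.+1) X i w)%R.

(* max_{1 <= k <= n} S_k, for n >= 1 *)
Definition max_partial_sum (T : Type) (R : realType) (X : nat -> T -> R)
    (n : nat) (w : T) : R :=
  (\big[Num.max/partial_sum X 1 w]_(1 <= k < n.+1) partial_sum X k w)%R.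

(* Q k is (a version of) <S>_k, the sum over 1 <= i <= k of
   E(X_i^2 | F_{i-1}). *)
Definition is_quadratic_characteristic d (T : measurableType d) (R : realType)
    (P : probability T R) (F : nat -> set (set T)) (X : nat -> T -> R)
    (Q : nat -> T -> \bar R) : Prop :=
  exists2 V : nat -> T -> \bar R,
    forall i, (1 <= i)%N ->
      is_cond_exp P (F i.-1) (fun w => (X i w ^+ 2)%:E) (V i)
  & forall k w, Q k w = \sum_(1 <= i < k.+1) V i w.

Definition exponential_moments d (T : measurableType d) (R : realType)
    (P : probability T R) (X : nat -> T -> R) (Q : nat -> T -> \bar R)
    (alpha C1 C2 : R) : Prop :=
  (forall i, (1 <= i)%N ->
     'E_P[fun w => expR (Num.max (X i w) 0 `^ (alpha / (1 - alpha)))%R]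
       <= C1%:E) /\
  (forall n, (1 <= n)%N ->
     \int[P]_w expeR (((n%:R^-1)%:E * Q n w) `^ (alpha / (1 - alpha))%R)
       <= C2%:E).

(* Strict stationarity of (X_i)_{i >= 1}: (X_1, ..., X_m) and
   (X_{h+1}, ..., X_{h+m}) have the same law on R^m. *)
Definition stationary d (T : measurableType d) (R : realType)
    (P : probability T R) (X : nat -> T -> R) : Prop :=
  forall (m h : nat) (B : set (m.-tuple R)), measurable B ->
    P [set w | B [tuple X (h + i.+1)%N w | i < m]] =
    P [set w | B [tuple X i.+1 w | i < m]].

(* f(n) = O(g(n)) with constant K *)
Definition bigO_with (R : realType) (K : R) (f g : nat -> R) : Prop :=
  forall n, (1 <= n)%N -> (`|f n| <= K * `|g n|)%R.

(* Main.v *)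
Require Import Defs.
From mathcomp Require Import ring lra zify.

(** Upper bound.  Truncate the increments above at y and stop the walk at the
    first passage of the level z.  The Bernstein bound for the exponential makes
    exp (l S_k - c <S>_k) a supermartingale for the truncated stopped walk
    (expR_step_le, integral_exp_process_le1), and Markov's inequality with the
    best l gives Freedman's inequality for the running maximum (freedman_max):
    P (max S_k >= z) is at most exp (- z^2 / (2 (V + y z / 3))), plus the
    probability that some X_i exceeds y, plus the probability that <S>_n exceeds
    V.  With z = n x, y = z^(1 - alpha) and V = n y, the first term is the
    Gaussian-like term of the statement, and the exponential moments bound the
    two other probabilities by multiples of exp (- z^alpha)
    (supermartingale_upper_bound).  At x = 1 the factor n in front of
    exp (- n^alpha) is absorbed by part of the exponential
    (supermartingale_bigO).

    Conditional expectations are handled through their defining integrals over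
    the sets of a sub-sigma-algebra G: an inequality between such integrals
    extends from indicator functions to all nonnegative G-measurable weights
    (le_integral_weight).

    Optimality.  Let X_i = eta e_i, where the e_i are fair signs and eta >= 0 is
    an independent random scale whose tail is exp (- 3/2 t^q), with
    q = 2 alpha / (1 - alpha).  Then |X_i| <= eta has the required exponential
    moment.  The sum of n terms reaches n if eta is at least n^((1 - alpha) / 2)
    and e_1 + ... + e_n is at least n^((1 + alpha) / 2); the first event has
    probability exp (- 3/2 n^alpha), and the second one, a moderate deviation of
    the simple random walk, has probability exp (- (1/2 + o(1)) n^alpha), of which
    exp (- 3/2 n^alpha) is a comfortable lower bound (walk_tail_lower_bound, from
    the binomial bound bin_lower_bound).

    The signs are the binary digits of a uniform variable.  The doubling map
    preserves the uniform law and shifts the digits, which gives stationarity;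
    reversing one digit also preserves it and changes the sign of one increment,
    which gives the martingale property. *)

Set Implicit Arguments.
Unset Strict Implicit.
Unset Printing Implicit Defensive.

Local Open Scope classical_set_scope.
Local Open Scope ring_scope.

(** * The Bernstein bound for the exponential function *)

Section bernstein_exp.
Context {R : realType}.
Implicit Types t u : R.

Lemma is_derive_ge0_le (f f' : R -> R) (a b : R) :
  (forall x : R, is_derive x 1 f (f' x)) -> (forall x, a < x < b -> 0 <= f' x) ->
  a <= b -> f a <= f b.
Proof.
move=> df f'0; rewrite le_eqVlt => /predU1P[->//|ab].
have cf : {within `[a, b], continuous f}.
  by apply: derivable_within_continuous => x _; exact: ex_derive.
have [c] := MVT ab (fun x _ => df x) cf.
rewrite in_itv/= => cab fE.
by rewrite -subr_ge0 fE mulr_ge0 ?f'0// subr_ge0 ltW.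
Qed.

Let k (u : R) : R := 1 - (1 + u + u ^+ 2 / 2) * expR (- u).

Let dk (u : R) : is_derive u 1 k (u ^+ 2 / 2 * expR (- u)).
Proof.
rewrite /k; apply: is_derive_eq.
by rewrite /GRing.scale/= !(mulr0, oppr0); field.
Qed.

Let k0 : k 0 = 0. Proof. by rewrite /k oppr0 expR0; ring. Qed.

Let dk_ge0 u : 0 <= u ^+ 2 / 2 * expR (- u).
Proof. by rewrite mulr_ge0 ?expR_ge0// divr_ge0// sqr_ge0. Qed.

Lemma expR_le_quadratic u : u <= 0 -> expR u <= 1 + u + u ^+ 2 / 2.
Proof.
move=> u0; have : k u <= k 0.
  by apply: (is_derive_ge0_le dk) => // *; exact: dk_ge0.
by rewrite k0 /k subr_le0 expRN ler_pdivlMr ?expR_gt0// mul1r.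
Qed.

(** The right-hand side times exp (- u), minus 1 - u / 3, has derivative k u / 3,
    where k is nonnegative on u >= 0; the fraction behind this inequality is the
    [2/1] Pade approximant of exp. *)
Lemma expR_le_pade u : 0 <= u ->
  expR u * (1 - u / 3) <= 1 + 2 / 3 * u + u ^+ 2 / 6.
Proof.
move=> u0.
pose h u := (1 + 2 / 3 * u + u ^+ 2 / 6) * expR (- u) - (1 - u / 3).
have dh (x : R) : is_derive x 1 h (k x / 3).
  rewrite /h; apply: is_derive_eq.
  by rewrite /GRing.scale/= /k !(mulr0, oppr0); field.
have : h 0 <= h u.
  apply: (is_derive_ge0_le dh) => // x /andP[x0 _].
  rewrite divr_ge0// -k0; apply: (is_derive_ge0_le dk) (ltW x0) => *.
  exact: dk_ge0.
rewrite {1}/h oppr0 expR0 mul0r subr0 mulr0 expr0n/= mul0r !addr0 mulr1 subrr.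
by rewrite /h subr_ge0 expRN ler_pdivlMr ?expR_gt0// mulrC.
Qed.

(** Only an upper bound t on u enters, and nothing is asked of its negative part:
    this is what allows a truncation from above only. *)
Lemma expR_le_bernstein t u : u <= t -> t < 3 -> 0 <= t ->
  expR u <= 1 + u + u ^+ 2 / (2 * (1 - t / 3)).
Proof.
move=> ut t3 t0.
have t30 : 0 < 1 - t / 3 by lra.
have [u0|u0] := leP u 0.
  apply: (le_trans (expR_le_quadratic _)) => //.
  rewrite lerD2l ler_wpM2l ?sqr_ge0// lef_pV2 ?posrE//; nra.
have u30 : 0 < 1 - u / 3 by lra.
apply: (@le_trans _ _ (1 + u + u ^+ 2 / (2 * (1 - u / 3)))).
  rewrite -(ler_pM2r u30); apply: (le_trans (expR_le_pade (ltW u0))).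
  by rewrite le_eqVlt; apply/orP; left; apply/eqP; field; lra.
rewrite lerD2l ler_wpM2l ?sqr_ge0// lef_pV2 ?posrE//; nra.
Qed.
End bernstein_exp.

(** * Integrating inequalities between set functions against weights *)

Section weights.
Context d (T : measurableType d) (R : realType) (P Q : {measure set T -> \bar R}).
Variables (G : set (set T)).
Hypotheses (sG : sigma_algebra [set: T] G) (Gm : G `<=` measurable).

Lemma measurable_sub_sigma (B : set T) : G.-sigma.-measurable B -> G B.
Proof. by rewrite (measurable_g_measurableTypeE sG). Qed.

Lemma measurable_wrtP d' (U : measurableType d') (Y : T -> U) :
  measurable_wrt G Y <->
  measurable_fun [set: g_sigma_algebraType G] (Y : g_sigma_algebraType G -> U).
Proof.
split=> mY; first by move=> _ B mB; rewrite setTI; apply: sub_sigma_algebra; exact: mY.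
by move=> B mB; apply: measurable_sub_sigma; rewrite -[_ @^-1` _]setTI; exact: mY.
Qed.

Lemma measurable_wrt_measurable_fun d' (U : measurableType d') (Y : T -> U) :
  measurable_wrt G Y -> measurable_fun [set: T] Y.
Proof. by move=> mY _ B mB; rewrite setTI; exact/Gm/mY. Qed.

Import HBNNSimple.

(** A G-measurable simple weight is constant on finitely many sets of G, and the
    hypothesis applies on each of them. *)
Lemma le_integral_weight_nnsfun (f g : T -> R)
    (h : {nnsfun (g_sigma_algebraType G) >-> R}) :
  measurable_fun [set: T] f -> (forall w, 0 <= f w) ->
  measurable_fun [set: T] g -> (forall w, 0 <= g w) ->
  (forall A, G A ->
     \int[P]_(w in A) (f w)%:E <= \int[Q]_(w in A) (g w)%:E)%E ->
  (\int[P]_w (f w * h w)%:E <= \int[Q]_w (g w * h w)%:E)%E.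
Proof.
move=> mf f0 mg g0 fg.
have Gh y : G (h @^-1` [set y]).
  by apply: measurable_sub_sigma; exact: measurable_sfunP.
have hE (P' : {measure set T -> \bar R}) (k : T -> R) :
    measurable_fun [set: T] k -> (forall w, 0 <= k w) ->
    (\int[P']_w (k w * h w)%:E =
     \sum_(y \in range h) y%:E * \int[P']_(w in h @^-1` [set y]) (k w)%:E)%E.
  move=> mk k0.
  transitivity (\int[P']_w \sum_(y \in range h)
      (y%:E * ((k w)%:E * (\1_(h @^-1` [set y]) w)%:E)))%E.
    apply: eq_integral => w _.
    rewrite [in LHS](fimfunE h) EFinM -fsumEFin// ge0_mule_fsumr; last first.
      by move=> y; exact: nnfun_muleindic_ge0.
    by apply: eq_fsbigr => y _; rewrite !EFinM muleCA.
  rewrite ge0_integral_fsum//.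
  - apply: eq_fsbigr => y; rewrite inE => -[w _ <-].
    rewrite ge0_integralZl//; last 3 first.
    + apply: emeasurable_funM; first exact/measurable_EFinP.
      apply/measurable_EFinP; apply: measurable_indic; exact/Gm/Gh.
    + by move=> x _; rewrite mule_ge0 ?lee_fin.
    + by rewrite lee_fin.
    congr (_ * _)%E; rewrite [RHS]integral_mkcond/=; apply: eq_integral => x _.
    by rewrite patchE indicE; case: ifPn => _; rewrite ?mule1 ?mule0.
  - move=> y; apply: emeasurable_funM => //.
    apply: emeasurable_funM; first exact/measurable_EFinP.
    apply/measurable_EFinP; apply: measurable_indic; exact/Gm/Gh.
  - move=> y w _; rewrite muleCA mule_ge0 ?lee_fin//.
    exact: nnfun_muleindic_ge0.
rewrite !hE// !fsbig_finite//= big_seq [leRHS]big_seq.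
apply: lee_sum => y.
rewrite in_fset_set// inE => -[w _ <-].
by apply: lee_wpmul2l; [rewrite lee_fin|exact: fg].
Qed.

(** This replaces the calculus of conditional expectations: an inequality between
    conditional expectations given G is the hypothesis, and its conclusion says
    that G-measurable factors may be pulled out.  Two different measures are
    allowed, so that G = measurable and f = 1 turn a density into a change of
    variables. *)
Lemma le_integral_weight (f g W : T -> R) :
  measurable_fun [set: T] f -> (forall w, 0 <= f w) ->
  measurable_fun [set: T] g -> (forall w, 0 <= g w) ->
  (forall A, G A ->
     \int[P]_(w in A) (f w)%:E <= \int[Q]_(w in A) (g w)%:E)%E ->
  measurable_wrt G W -> (forall w, 0 <= W w) ->
  (\int[P]_w (f w * W w)%:E <= \int[Q]_w (g w * W w)%:E)%E.
Proof.
move=> mf f0 mg g0 fg /measurable_wrtP mW W0.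
have mEW : measurable_fun [set: g_sigma_algebraType G] (EFin \o W).
  exact/measurable_EFinP.
pose h n : {nnsfun (g_sigma_algebraType G) >-> R} := nnsfun_approx measurableT mEW n.
have mh n : measurable_fun [set: T] (h n : T -> R).
  by apply: measurable_wrt_measurable_fun; exact/measurable_wrtP.
have nd (k : T -> R) w : (forall w, 0 <= k w) ->
    {homo (fun n => (k w * h n w)%:E) : m n / (m <= n)%N >-> (m <= n)%E}.
  move=> k0 m n mn; rewrite lee_fin ler_wpM2l//.
  by have /lefP := nd_nnsfun_approx measurableT mEW mn; apply.
have limE (P' : {measure set T -> \bar R}) (k : T -> R) :
    measurable_fun [set: T] k -> (forall w, 0 <= k w) ->
    (\int[P']_w (k w * h n w)%:E)%E @[n --> \oo] --> (\int[P']_w (k w * W w)%:E)%E.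
  move=> mk k0.
  rewrite (_ : (\int[P']_w (k w * W w)%:E)%E =
     (\int[P']_w limn (fun n => (k w * h n w)%R%:E))%E).
    apply: cvg_monotone_convergence => //.
    - by move=> n; apply/measurable_EFinP/measurable_funM.
    - by move=> n w _; rewrite lee_fin mulr_ge0.
    - by move=> w _; exact: nd.
  apply: eq_integral => w _; apply/esym/cvg_lim => //.
  rewrite EFinM; under eq_fun do rewrite EFinM.
  apply: cvgeZl => //.
  exact: (cvg_nnsfun_approx measurableT mEW (fun x _ => W0 x) (x := w)).
apply: lee_cvg_to (limE P f mf f0) (limE Q g mg g0) _.
by apply: nearW => n; exact: le_integral_weight_nnsfun.
Qed.
End weights.

(** * One step of the exponential supermartingale *)

Section step.
Context d (T : measurableType d) (R : realType) (P : probability T R).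
Variables (G : set (set T)).
Hypotheses (sG : sigma_algebra [set: T] G) (Gm : G `<=` measurable).

(** E(X | G) <= 0, in the form required by weights: both sides are integrals of
    nonnegative functions. *)
Lemma supermartingale_difference_pos_le_neg (X : T -> R) (Y : T -> \bar R) :
  P.-integrable [set: T] (EFin \o X) ->
  is_cond_exp P G (EFin \o X) Y -> {ae P, forall w, (Y w <= 0)%E} ->
  forall A, G A ->
  (\int[P]_(w in A) (Num.max (X w) 0)%:E <=
   \int[P]_(w in A) (Num.max (- X w) 0)%:E)%E.
Proof.
move=> iX [mY XY] Y0 A GA; have mA := Gm GA.
have mY' := measurable_wrt_measurable_fun Gm mY.
have iXA : P.-integrable A (EFin \o X) by exact: integrableS iX.
have : (\int[P]_(w in A) Y w <= 0)%E.
  rewrite integralE (_ : (\int[P]_(w in A) Y^\+ w = 0)%E); last first.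
    transitivity (\int[P]_(w in A) (cst 0 w) : \bar R)%E; last exact: integral0.
    apply: ae_eq_integral => //.
      by apply: measurable_funTS; exact: measurable_funepos.
    by apply: filterS Y0 => w Yw _ /=; rewrite funeposE; exact/max_idPr.
  by rewrite sub0e oppe_le0 integral_ge0// => w _.
rewrite XY// integralE sube_le0.
  by under eq_integral do rewrite funeposE/= -EFin_max;
  under [X in (_ <= X)%E]eq_integral do rewrite funenegE/= -EFin_max.
Qed.

(** Let xi be X truncated above at y and switched on by b, and let
    c = l^2 / (2 (1 - l y / 3)).  By the Bernstein bound
    exp (l xi) <= 1 + l b X + c X^2, whose conditional expectation is at most
    1 + c v <= exp (c v) as soon as v dominates E(X^2 | G).  Hence the factor
    exp (l xi - c v) does not increase the integral of a G-measurable weight.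
    The switch b serves to stop the walk. *)
Lemma expR_step_le (X v W : T -> R) (b : T -> bool) (K y l : R) :
  P.-integrable [set: T] (EFin \o X) ->
  (forall A, G A -> (\int[P]_(w in A) (Num.max (X w) 0)%:E <=
                     \int[P]_(w in A) (Num.max (- X w) 0)%:E)%E) ->
  measurable_wrt G v -> (forall w, 0 <= v w) ->
  (forall A, G A -> (\int[P]_(w in A) (X w ^+ 2)%:E <=
                     \int[P]_(w in A) (v w)%:E)%E) ->
  measurable_wrt G b ->
  measurable_wrt G W -> (forall w, 0 <= W w <= K) ->
  0 < l -> 0 <= y -> l * y < 3 ->
  (\int[P]_w (W w * expR (l * (if b w && (X w <= y)%R then X w else 0)
                  - l ^+ 2 / (2 * (1 - l * y / 3)) * v w))%:E
   <= \int[P]_w (W w)%:E)%E.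
Proof.
move=> iX Xle gv v0 Xv gb gW WK l0 y0 ly3.
set c := l ^+ 2 / _.
have D0 : 0 < 1 - l * y / 3 by lra.
have c0 : 0 <= c by rewrite divr_ge0 ?sqr_ge0// mulr_ge0// ltW.
have W0 w : 0 <= W w by have /andP[] := WK w.
have mX : measurable_fun [set: T] X.
  by apply/measurable_EFinP; exact: (measurable_int P).
pose W' w := W w * expR (- (c * v w)).
pose U w := l * (if b w then 1 else 0) * W' w.
have W'0 w : 0 <= W' w by rewrite mulr_ge0// expR_ge0.
have b01 w : 0 <= (if b w then 1 else 0 : R) <= 1 by case: (b w); rewrite ?lexx ler01.
have U0 w : 0 <= U w.
  by rewrite mulr_ge0// mulr_ge0 ?(ltW l0)//; have /andP[] := b01 w.
have W'W w : W' w <= W w.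
  by rewrite ler_piMr// expR_le1 oppr_le0 mulr_ge0.
have gW' : measurable_wrt G W'.
  apply/measurable_wrtP => //; apply: measurable_funM; first exact/measurable_wrtP.
  apply: measurableT_comp => //; apply: measurableT_comp => //.
  by apply: measurable_funM => //; exact/measurable_wrtP.
have gU : measurable_wrt G U.
  apply/measurable_wrtP => //; apply: measurable_funM; last exact/measurable_wrtP.
  by apply: measurable_funM => //; apply: measurable_fun_ifT => //; exact/measurable_wrtP.
have gcW' : measurable_wrt G (fun w => c * W' w).
  by apply/measurable_wrtP => //; apply: measurable_funM => //; exact/measurable_wrtP.
have mW := measurable_wrt_measurable_fun Gm gW.
have mW' := measurable_wrt_measurable_fun Gm gW'.
have mv := measurable_wrt_measurable_fun Gm gv.
have mU := measurable_wrt_measurable_fun Gm gU.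
have mb := measurable_wrt_measurable_fun Gm gb.
pose xi w := if b w && (X w <= y) then X w else 0.
have mxi : measurable_fun [set: T] xi.
  apply: measurable_fun_ifT => //; apply: measurable_and => //.
  exact: measurable_fun_ler.
have mXp : measurable_fun [set: T] (fun w => Num.max (X w) 0).
  exact: measurable_maxr.
have mXn : measurable_fun [set: T] (fun w => Num.max (- X w) 0).
  by apply: measurable_maxr => //; exact: measurableT_comp.
have mX2 : measurable_fun [set: T] (fun w => X w ^+ 2).
  exact: measurable_funX.
have mexi : measurable_fun [set: T] (fun w => expR (l * xi w) * W' w).
  apply: measurable_funM => //; apply: measurableT_comp => //.
  exact: measurable_funM.
(* Moving the negative part of X to the left keeps every term nonnegative, so
   that the integrals below are additive without integrability conditions. *)
have pointwise w : expR (l * xi w) * W' w + Num.max (- X w) 0 * U w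
   <= W' w + (Num.max (X w) 0 * U w + X w ^+ 2 * (c * W' w)).
  have -> : Num.max (X w) 0 = X w + Num.max (- X w) 0.
    have [X0|X0] := leP 0 (X w).
      by rewrite max_r ?addr0// oppr_le0.
    by rewrite max_l ?subrr// oppr_ge0 ltW.
  suff H : expR (l * xi w) <= 1 + l * (if b w then 1 else 0) * X w + c * X w ^+ 2.
    by have := ler_wpM2r (W'0 w) H; rewrite /U; nra.
  rewrite /xi; case: ifPn => [/andP[-> Xy]|].
    have := @expR_le_bernstein R (l * y) (l * X w).
    rewrite ler_pM2l// mulr_ge0 ?(ltW l0)// => /(_ Xy ly3 isT).
    by move=> /le_trans; apply; rewrite mulr1 exprMn /c; lra.
  rewrite negb_and mulr0 expR0 => bX.
  have cX : 0 <= c * X w ^+ 2 by rewrite mulr_ge0 ?sqr_ge0.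
  case: (b w) bX => /= [|_]; last by lra.
  by rewrite -ltNge mulr1 => yX; have := mulr_ge0 (ltW l0) (le_trans y0 (ltW yX)); lra.
have Xp0 w : 0 <= Num.max (X w) 0 * U w by rewrite mulr_ge0// le_max lexx orbT.
have Xq0 w : 0 <= X w ^+ 2 * (c * W' w) by rewrite mulr_ge0 ?sqr_ge0// mulr_ge0.
have vq0 w : 0 <= v w * (c * W' w) by rewrite mulr_ge0// mulr_ge0.
pose F2 := (\int[P]_w (Num.max (- X w) 0 * U w)%:E)%E.
have F2fin : F2 \is a fin_num.
  rewrite ge0_fin_numE; last first.
    by apply: integral_ge0 => w _; rewrite lee_fin mulr_ge0// le_max lexx orbT.
  have K0 : 0 <= l * K.
    by rewrite mulr_ge0 ?(ltW l0)//; have /andP[W0w] := WK point; exact: le_trans.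
  apply: (@le_lt_trans _ _ (\int[P]_w ((l * K)%:E * `|(X w)%:E|))%E).
    apply: ge0_le_integral => //.
    - by move=> w _; rewrite lee_fin mulr_ge0// le_max lexx orbT.
    - by apply/measurable_EFinP/measurable_funM.
    - apply: measurable_funeM; apply: measurableT_comp => //.
      exact/measurable_EFinP.
    - move=> w _; rewrite lee_fin mulrC ler_pM//.
      + by rewrite le_max lexx orbT.
      + rewrite /U -mulrA ler_wpM2l ?(ltW l0)//.
        have /andP[W0w WKw] := WK w; apply: le_trans WKw.
        by apply: le_trans (W'W w); rewrite ler_piMl//; have /andP[] := b01 w.
      + by rewrite ge_max -normrN ler_norm normr_ge0.
  rewrite ge0_integralZl//.
  - rewrite lte_mul_pinfty//; have /integrableP[_] := iX; exact.
  - by apply: measurableT_comp => //; exact/measurable_EFinP.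
have -> : (\int[P]_w (W w * expR (l * xi w - c * v w))%:E)%E =
          (\int[P]_w (expR (l * xi w) * W' w)%:E)%E.
  by apply: eq_integral => w _; rewrite /W' expRD mulrCA.
(* F2 is finite and can be cancelled once the weighted form of E(X | G) <= 0
   has made it reappear on the right-hand side. *)
rewrite -(leeD2rE _ _ F2fin) /F2.
rewrite -ge0_integralD//; last 4 first.
- by move=> w _; rewrite lee_fin mulr_ge0// expR_ge0.
- exact/measurable_EFinP.
- by move=> w _; rewrite lee_fin mulr_ge0// le_max lexx orbT.
- by apply/measurable_EFinP/measurable_funM.
apply: (@le_trans _ _ (\int[P]_w ((W' w)%:E +
    ((Num.max (X w) 0 * U w)%:E + (X w ^+ 2 * (c * W' w))%:E)))%E).
  apply: ge0_le_integral => //.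
  - by move=> w _; rewrite lee_fin addr_ge0// mulr_ge0 ?expR_ge0// le_max lexx orbT.
  - by apply/measurable_EFinP/measurable_funD => //; exact: measurable_funM.
  - apply/measurable_EFinP/measurable_funD => //; apply: measurable_funD.
      exact: measurable_funM.
    by apply: measurable_funM => //; exact: measurable_funM.
  - by move=> w _; rewrite -!EFinD lee_fin.
rewrite ge0_integralD//; last 4 first.
- by move=> w _; rewrite lee_fin.
- exact/measurable_EFinP.
- by move=> w _; rewrite -EFinD lee_fin addr_ge0 ?Xp0 ?Xq0.
- apply/measurable_EFinP; apply: measurable_funD; first exact: measurable_funM.
  by apply: measurable_funM => //; exact: measurable_funM.
rewrite ge0_integralD//; last 4 first.
- by move=> w _; rewrite lee_fin Xp0.
- by apply/measurable_EFinP/measurable_funM.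
- by move=> w _; rewrite lee_fin Xq0.
- by apply/measurable_EFinP/measurable_funM => //; exact: measurable_funM.
apply: (@le_trans _ _ (\int[P]_w (W' w)%:E + (F2 + \int[P]_w (v w * (c * W' w))%:E))%E).
  apply: leeD => //; apply: leeD.
    apply: (le_integral_weight sG Gm) => //.
    - by move=> w; rewrite le_max lexx orbT.
    - by move=> w; rewrite le_max lexx orbT.
  apply: (le_integral_weight sG Gm) => //.
  - by move=> w; exact: sqr_ge0.
  - by move=> w; rewrite mulr_ge0.
rewrite addeCA addeC leeD2r// -ge0_integralD//; last 4 first.
- by move=> w _; rewrite lee_fin.
- exact/measurable_EFinP.
- by move=> w _; rewrite lee_fin vq0.
- by apply/measurable_EFinP/measurable_funM => //; exact: measurable_funM.
apply: ge0_le_integral => //.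
- by move=> w _; rewrite lee_fin addr_ge0// vq0.
- apply/measurable_EFinP/measurable_funD => //.
  by apply: measurable_funM => //; exact: measurable_funM.
- exact/measurable_EFinP.
- move=> w _; rewrite lee_fin.
  have -> : W' w + v w * (c * W' w) = W w * ((1 + c * v w) * expR (- (c * v w))).
    by rewrite /W'; ring.
  by rewrite ler_piMr// expRN ler_pdivrMr ?expR_gt0// mul1r expR_ge1Dx.
Qed.
End step.

(** * A Freedman inequality for the running maximum *)

(** The walk with increments truncated above at y, frozen as soon as it reaches
    the level z: its value at time n remembers the running maximum. *)
Fixpoint stopped_sum (T : Type) (R : realType) (X : nat -> T -> R) (y z : R)
    (k : nat) (w : T) : R :=
  if k is j.+1 then
    let s := stopped_sum X y z j w in
    s + (if (s < z) && (X k w <= y) then X k w else 0)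
  else 0.

Lemma le_stopped_sum (T : Type) (R : realType) (X : nat -> T -> R) (y z : R) k w :
  0 <= y -> stopped_sum X y z k w <= k%:R * y.
Proof.
move=> y0; elim: k => [|k IH] /=; first by rewrite mul0r.
rewrite -natr1 mulrDl mul1r lerD//.
by case: ifPn => // /andP[].
Qed.

Lemma stopped_sum_ge (T : Type) (R : realType) (X : nat -> T -> R) (y z : R) n w :
  0 < z -> (1 <= n)%N -> (forall i, (1 <= i < n.+1)%N -> X i w <= y) ->
  z <= max_partial_sum X n w -> z <= stopped_sum X y z n w.
Proof.
move=> z0 n1 Xy; apply: contraTT; rewrite -!ltNge => sz.
(* As long as the level z has not been passed, nothing has been stopped. *)
have H k : (k <= n)%N -> stopped_sum X y z k w < z ->
    stopped_sum X y z k w = partial_sum X k w /\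
    forall j, (j <= k)%N -> partial_sum X j w < z.
  elim: k => [_ _|k IH kn].
    have S0 : partial_sum X 0 w = 0 by rewrite /partial_sum big_geq.
    by rewrite S0; split=> // -[|//]; rewrite S0.
  rewrite /= => skz.
  have sk : stopped_sum X y z k w < z.
    rewrite ltNge; apply/negP => zs; move: skz.
    by rewrite [in X in _ + X](ltNge _ z) zs/= addr0 ltNge zs.
  have [sE Sz] := IH (ltnW kn) sk.
  move: skz; rewrite sk Xy//= sE => Skz.
  have SE : partial_sum X k w + X k.+1 w = partial_sum X k.+1 w.
    by rewrite /partial_sum [RHS]big_nat_recr.
  split; first by rewrite SE.
  move=> j; rewrite leq_eqVlt => /predU1P[->|/Sz//].
  by rewrite -SE.
have [_ Sz] := H _ (leqnn n) sz.
rewrite /max_partial_sum big_seq; apply: bigmax_lt; first exact: Sz.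
by move=> j; rewrite mem_index_iota => /andP[_]; exact: Sz.
Qed.

Lemma measurable_set_lt d (T : measurableType d) (R : realType) (f g : T -> R) :
  measurable_fun [set: T] f -> measurable_fun [set: T] g ->
  measurable [set w | f w < g w].
Proof.
move=> mf mg; rewrite -[X in measurable X]setTI.
exact: (measurable_fun_ltr mf mg measurableT (Y := [set true])).
Qed.

Lemma measurable_set_le d (T : measurableType d) (R : realType) (f g : T -> R) :
  measurable_fun [set: T] f -> measurable_fun [set: T] g ->
  measurable [set w | f w <= g w].
Proof.
move=> mf mg; rewrite -[X in measurable X]setTI.
exact: measurable_fun_le.
Qed.

Lemma measurable_max_partial_sum d (T : measurableType d) (R : realType)
    (X : nat -> T -> R) n :
  (forall i, (1 <= i)%N -> measurable_fun [set: T] (X i)) ->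
  measurable_fun [set: T] (max_partial_sum X n).
Proof.
move=> mX.
have mS k : measurable_fun [set: T] (partial_sum X k).
  rewrite /partial_sum; elim: k => [|k IH].
    by under eq_fun do rewrite big_geq//; exact: measurable_cst.
  by under eq_fun do rewrite big_nat_recr//=; apply: measurable_funD => //; exact: mX.
rewrite /max_partial_sum; elim: (index_iota _ _) => [|k r IH].
  by under eq_fun do rewrite big_nil; exact: mS.
by under eq_fun do rewrite big_cons; exact: measurable_maxr.
Qed.

Section freedman.
Context d (T : measurableType d) (R : realType) (P : probability T R).
Variables (F : nat -> set (set T)) (X v : nat -> T -> R).
Hypothesis filtF : filtration F.
Hypothesis iX : forall i, (1 <= i)%N -> P.-integrable [set: T] (EFin \o X i).
Hypothesis FX : forall i, (1 <= i)%N -> measurable_wrt (F i) (X i).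
Hypothesis superX : forall i, (1 <= i)%N -> forall A, F i.-1 A ->
  (\int[P]_(w in A) (Num.max (X i w) 0)%:E <=
   \int[P]_(w in A) (Num.max (- X i w) 0)%:E)%E.
Hypothesis Fv : forall i, (1 <= i)%N -> measurable_wrt (F i.-1) (v i).
Hypothesis v0 : forall i w, 0 <= v i w.
Hypothesis X2v : forall i, (1 <= i)%N -> forall A, F i.-1 A ->
  (\int[P]_(w in A) (X i w ^+ 2)%:E <= \int[P]_(w in A) (v i w)%:E)%E.

Let sF i : sigma_algebra [set: T] (F i). Proof. by have [+ _ _] := filtF; exact. Qed.
Let Fm i : F i `<=` measurable. Proof. by have [_ + _] := filtF; exact. Qed.
Let FS i : F i `<=` F i.+1. Proof. by have [_ _] := filtF; exact. Qed.

Let measurable_wrtS i d' (U : measurableType d') (Y : T -> U) :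
  measurable_wrt (F i) Y -> measurable_wrt (F i.+1) Y.
Proof. by move=> FY B mB; exact/FS/FY. Qed.

Lemma measurable_wrt_stopped_sum y z k :
  measurable_wrt (F k) (stopped_sum X y z k).
Proof.
elim: k => [|k IH].
  by apply/measurable_wrtP => //; exact: measurable_cst.
have /(measurable_wrtP (sF k.+1)) mS := measurable_wrtS IH.
have /(measurable_wrtP (sF k.+1)) mX := FX (ltn0Sn k).
apply/measurable_wrtP => //=; apply: measurable_funD => //.
apply: measurable_fun_ifT => //; apply: measurable_and.
  exact: measurable_fun_ltr.
exact: measurable_fun_ler.
Qed.

Lemma measurable_wrt_sum_v k :
  measurable_wrt (F k) (fun w => \sum_(1 <= i < k.+1) v i w).
Proof.
elim: k => [|k IH]; apply/measurable_wrtP => //.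
  by under eq_fun do rewrite big_geq//; exact: measurable_cst.
under eq_fun do rewrite big_nat_recr//=.
apply: measurable_funD; apply/measurable_wrtP => //; first exact: measurable_wrtS.
exact: measurable_wrtS (Fv (ltn0Sn k)).
Qed.

Definition exp_process (y z l c : R) k w :=
  expR (l * stopped_sum X y z k w - c * \sum_(1 <= i < k.+1) v i w).

(** Iteration of the one-step inequality; the stopped truncated walk is bounded
    above by k y, so the process is a bounded weight at every step. *)
Lemma integral_exp_process_le1 (y z l : R) k :
  0 < l -> 0 <= y -> l * y < 3 ->
  (\int[P]_w (exp_process y z l (l ^+ 2 / (2 * (1 - l * y / 3))) k w)%:E <= 1)%E.
Proof.
move=> l0 y0 ly3; set c := l ^+ 2 / _.
have c0 : 0 <= c.
  by rewrite divr_ge0 ?sqr_ge0// mulr_ge0//; lra.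
elim: k => [|k IH].
  under eq_integral do rewrite /exp_process/= big_geq// !mulr0 subr0 expR0.
  by rewrite integral_cst//= mul1e probability_setT.
apply: le_trans IH.
rewrite (_ : (\int[P]_w (exp_process y z l c k.+1 w)%:E)%E =
  (\int[P]_w (exp_process y z l c k w * expR (l *
    (if (stopped_sum X y z k w < z) && (X k.+1 w <= y)%R then X k.+1 w else 0)
     - c * v k.+1 w))%:E)%E); last first.
  apply: eq_integral => w _; rewrite /exp_process -expRD; congr (expR _)%:E.
  by rewrite big_nat_recr//=; ring.
apply: (@expR_step_le _ _ _ P (F k) (sF k) (@Fm k) (X k.+1) (v k.+1)
  (exp_process y z l c k) (fun w => stopped_sum X y z k w < z)
  (expR (l * (k%:R * y))) y l) => //.
- exact: iX.
- exact: (superX (ltn0Sn k)).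
- exact: (Fv (ltn0Sn k)).
- exact: (X2v (ltn0Sn k)).
- apply/measurable_wrtP => //; apply: measurable_fun_ltr => //.
  by apply/measurable_wrtP => //; exact: measurable_wrt_stopped_sum.
- apply/measurable_wrtP => //; apply: measurableT_comp => //.
  apply: measurable_funB; apply: measurable_funM => //; apply/measurable_wrtP => //.
    exact: measurable_wrt_stopped_sum.
  exact: measurable_wrt_sum_v.
- move=> w; rewrite expR_ge0/= ler_expR lerBlDr -[leLHS]addr0 lerD//.
    by rewrite ler_wpM2l ?(ltW l0)// le_stopped_sum.
  by rewrite mulr_ge0// sumr_ge0.
Qed.

Lemma measurable_wrt_mfun i d' (U : measurableType d') (Y : T -> U) :
  measurable_wrt (F i) Y -> measurable_fun [set: T] Y.
Proof. by apply: measurable_wrt_measurable_fun. Qed.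

(** On this event the exponential process is at least exp (l z - c V2), while its
    mean is at most 1. *)
Lemma freedman_stopped (y z V2 : R) n :
  0 < z -> 0 <= y -> 0 < V2 ->
  (P [set w | (z <= stopped_sum X y z n w /\ \sum_(1 <= i < n.+1) v i w <= V2)%R]
   <= (expR (- (z ^+ 2 / (2 * (V2 + y * z / 3)))))%:E)%E.
Proof.
move=> z0 y0 V20.
have yz0 : 0 <= y * z by rewrite mulr_ge0// ltW.
have D0 : 0 < V2 + y * z / 3 by lra.
(* This exponent turns c * V2 - l * z into Bernstein's expression exactly. *)
pose l := z / (V2 + y * z / 3).
have l0 : 0 < l by rewrite divr_gt0.
have ly3 : l * y < 3 by rewrite /l mulrAC ltr_pdivrMr//; lra.
have := @integral_exp_process_le1 y z l n l0 y0 ly3.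
set c := l ^+ 2 / _ => M1.
have cE : c = z ^+ 2 / (2 * (V2 + y * z / 3) * V2).
  by rewrite /c /l; field; lra.
have c0 : 0 <= c by rewrite cE divr_ge0 ?sqr_ge0// mulr_ge0// ?mulr_ge0// ltW.
set A := [set w | _].
have mM : measurable_fun [set: T] (exp_process y z l c n).
  apply: measurableT_comp => //.
  apply: measurable_funB; apply: measurable_funM => //; apply: measurable_wrt_mfun.
    exact: measurable_wrt_stopped_sum.
  exact: measurable_wrt_sum_v.
have mA : measurable A.
  apply: measurableI; apply: measurable_set_le => //.
    exact/measurable_wrt_mfun/measurable_wrt_stopped_sum.
  exact/measurable_wrt_mfun/measurable_wrt_sum_v.
have -> : expR (- (z ^+ 2 / (2 * (V2 + y * z / 3)))) = expR (c * V2 - l * z).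
  by congr expR; rewrite cE /l; field; lra.
rewrite -[A]setIT -integral_indic//.
apply: (@le_trans _ _ (\int[P]_w ((expR (c * V2 - l * z))%:E *
    (exp_process y z l c n w)%:E))%E).
  apply: ge0_le_integral => //.
  - by apply/measurable_EFinP; exact: measurable_indic.
  - by apply: measurable_funeM; exact/measurable_EFinP.
  - move=> w _; rewrite -EFinM lee_fin indicE.
    case: (boolP (w \in A)) => [|_]; last by rewrite mulr_ge0// expR_ge0.
    rewrite inE => -[zs sV]; rewrite -expRD -[leLHS]expR0 ler_expR.
    have := ler_wpM2l (ltW l0) zs; have := ler_wpM2l c0 sV; lra.
rewrite ge0_integralZl//.
- by rewrite -[leRHS]mule1 lee_wpmul2l// lee_fin expR_ge0.
- exact/measurable_EFinP.
- by move=> w _; rewrite lee_fin expR_ge0.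
Qed.

(** Either some increment exceeds y, or the quadratic characteristic exceeds V2,
    or else truncation changes nothing up to the first passage of the level z and
    the stopped walk ends above z. *)
Theorem freedman_max (y z V2 : R) n :
  0 < z -> 0 <= y -> 0 < V2 -> (1 <= n)%N ->
  (P [set w | (z <= max_partial_sum X n w)%R] <=
   (expR (- (z ^+ 2 / (2 * (V2 + y * z / 3)))))%:E +
   (\sum_(1 <= i < n.+1) P [set w | (y < X i w)%R] +
    P [set w | (V2 < \sum_(1 <= i < n.+1) v i w)%R]))%E.
Proof.
move=> z0 y0 V20 n1.
have mX i : (1 <= i)%N -> measurable_fun [set: T] (X i).
  by move=> i1; exact/measurable_wrt_mfun/FX.
pose E1 := [set w | z <= stopped_sum X y z n w /\ \sum_(1 <= i < n.+1) v i w <= V2].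
pose E2 := \big[setU/set0]_(1 <= i < n.+1) [set w | y < X i w].
pose E3 := [set w | V2 < \sum_(1 <= i < n.+1) v i w].
have mE1 : measurable E1.
  apply: measurableI; apply: measurable_set_le => //.
    exact/measurable_wrt_mfun/measurable_wrt_stopped_sum.
  exact/measurable_wrt_mfun/measurable_wrt_sum_v.
have mXy i : (1 <= i)%N -> measurable [set w | y < X i w].
  move=> i1; apply: measurable_set_lt => //.
  exact: mX.
have mE2 : measurable E2.
  rewrite /E2 big_seq; apply: bigsetU_measurable => i.
  by rewrite mem_index_iota => /andP[i1 _]; exact: mXy.
have mE3 : measurable E3.
  apply: measurable_set_lt => //.
  exact/measurable_wrt_mfun/measurable_wrt_sum_v.
apply: (@le_trans _ _ (P (E1 `|` (E2 `|` E3)))).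
  apply: le_measure; rewrite ?inE.
  - by apply: measurable_set_le => //; exact: measurable_max_partial_sum.
  - by apply: measurableU => //; exact: measurableU.
  - move=> w /= zS.
    have [Xy|] := pselect (forall i, (1 <= i < n.+1)%N -> X i w <= y).
      have [sV|Vs] := leP (\sum_(1 <= i < n.+1) v i w) V2.
        by left; split=> //; exact: stopped_sum_ge.
      by right; right.
    move=> /existsNP[i /not_implyP[i1n /negP]]; rewrite -ltNge => yX.
    right; left; rewrite /E2 -bigcup_seq; exists i => //=.
    by rewrite mem_index_iota.
apply: le_trans (measureU2 P mE1 (measurableU _ _ mE2 mE3)) _.
apply: leeD; first exact: freedman_stopped.
apply: le_trans (measureU2 P mE2 mE3) _.
rewrite leeD2r// /E2.
have : forall i, (i \in index_iota 1 n.+1) -> (1 <= i)%N.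
  by move=> i; rewrite mem_index_iota => /andP[].
elim: (index_iota _ _) => [_|i r IH r1]; first by rewrite !big_nil measure0.
rewrite !big_cons.
have mr : measurable (\big[setU/set0]_(j <- r) [set w | y < X j w]).
  rewrite big_seq; apply: bigsetU_measurable => j jr.
  by apply: mXy; apply: r1; rewrite inE jr orbT.
apply: le_trans (measureU2 P (mXy i (r1 _ (mem_head _ _))) mr) _.
by apply: leeD => //; apply: IH => j jr; apply: r1; rewrite inE jr orbT.
Qed.
End freedman.

(** * The upper bound under exponential moments *)

Lemma measurable_expeR (R : realType) : measurable_fun [set: \bar R] (@expeR R).
Proof.
have -> : @expeR R = (fun x => maxe (er_map expR x) 0%E).
  apply/funext => -[r| |] /=.
  - by rewrite max_l// lee_fin expR_ge0.
  - by rewrite max_l// leey.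
  - by rewrite max_r.
apply: measurable_maxe; last exact: measurable_cst. 
exact: (@measurable_er_map _ R R _ (@measurable_expR R)).
Qed.

Lemma exponential_markov d (T : measurableType d) (R : realType)
    (P : probability T R) (g : T -> \bar R) (E : set T) (s C : R) :
  measurable_fun [set: T] g -> (forall w, (0 <= g w)%E) -> measurable E ->
  {ae P, forall w, E w -> ((expR s)%:E <= g w)%E} ->
  (\int[P]_w g w <= C%:E)%E -> (P E <= (C * expR (- s))%:E)%E.
Proof.
move=> mg g0 mE Eg gC.
have : ((expR s)%:E * P E <= C%:E)%E.
  apply: le_trans gC.
  rewrite -[E in leLHS]setIT -integral_indic// -ge0_integralZl//; last first.
    by apply/measurable_EFinP; exact: measurable_indic.
  apply: ae_ge0_le_integral => //.
  - by apply: measurable_funeM; apply/measurable_EFinP; exact: measurable_indic.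
  - apply: filterS Eg => w Ew _; rewrite indicE.
    case: (boolP (w \in E)) => [|_]; last by rewrite mule0.
    by rewrite inE mule1 => /Ew.
have PE : P E \is a fin_num by exact: fin_num_measure.
rewrite -(fineK PE) -EFinM !lee_fin => H.
by rewrite expRN ler_pdivlMr ?expR_gt0// mulrC.
Qed.

Section conditional_variance.
Context d (T : measurableType d) (R : realType) (P : probability T R).
Variables (F : nat -> set (set T)) (X : nat -> T -> R) (V : nat -> T -> \bar R).
Hypothesis filtF : filtration F.
Hypothesis ceV : forall i, (1 <= i)%N ->
  is_cond_exp P (F i.-1) (fun w => (X i w ^+ 2)%:E) (V i).

Lemma measurable_cond_var i : (1 <= i)%N -> measurable_fun [set: T] (V i).
Proof.
move=> i1; have [mV _] := ceV i1; have [_ Fm _] := filtF.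
exact (measurable_wrt_measurable_fun (Fm i.-1) mV).
Qed.

(** V i is only known through its integrals, which allow negative values on a
    null set. *)
Lemma cond_var_ge0 i : (1 <= i)%N -> {ae P, forall w, (0 <= V i w)%E}.
Proof.
move=> i1; have [mV VX] := ceV i1.
(* The set where V i < 0 is an admissible test set in the definition of V i. *)
pose A := V i @^-1` [set x | (x < 0)%E].
have FA : F i.-1 A.
  apply: mV; rewrite (_ : [set _ | _] = `]-oo, 0%E[%classic); first exact: emeasurable_itv.
  by apply/seteqP; split=> x /=; rewrite in_itv.
have [_ Fm _] := filtF; have mA : measurable A := Fm _ _ FA.
have mVA : measurable_fun A (V i) by apply: measurable_funTS; exact: measurable_cond_var.
have V0 : (\int[P]_(w in A) `|V i w| = 0)%E.
  apply/eqP; rewrite eq_le integral_ge0 ?andbT// -oppe_ge0 -integral_ge0N//.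
  rewrite (eq_integral (V i)); last first.
    by move=> w; rewrite inE => Aw; rewrite lee0_abs ?oppeK// ltW.
  by rewrite VX// integral_ge0// => w _; rewrite lee_fin sqr_ge0.
have /(ae_eq_integral_abs _ mA mVA) := V0.
apply: filterS => w Aw; rewrite leNgt; apply/negP => Vw.
by have := Aw Vw; move: Vw => /[swap] ->; rewrite ltxx.
Qed.

Variables (r C2 : R).
Hypothesis r0 : 0 < r.
Hypothesis momQ : forall n, (1 <= n)%N ->
  (\int[P]_w expeR ((((n%:R^-1)%:E * \sum_(1 <= i < n.+1) V i w) `^ r)%E) <= C2%:E)%E.

Let mQ n : measurable_fun [set: T] (fun w => \sum_(1 <= i < n.+1) V i w)%E.
Proof.
elim: n => [|n IH]; first by under eq_fun do rewrite big_geq//; exact: measurable_cst.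
under eq_fun do rewrite big_nat_recr//=.
by apply: emeasurable_funD => //; exact: measurable_cond_var.
Qed.

Let mg n : measurable_fun [set: T] (fun w =>
  expeR ((((n%:R^-1)%:E * \sum_(1 <= i < n.+1) V i w) `^ r)%E)).
Proof.
apply: measurableT_comp; first exact: measurable_expeR.
apply: (measurableT_comp (measurable_poweR r)).
by apply: measurable_funeM; exact: mQ.
Qed.

(** A version of E(X_i^2 | F_(i-1)) which is real and nonnegative everywhere. *)
Definition real_var i w : R := `|fine (V i w)|.

(** The conditional variances are a priori extended reals, since X_i need not be
    square integrable; the exponential moment of their sum makes them finite
    almost surely. *)
Lemma cond_var_fin :
  {ae P, forall w, forall i, (1 <= i)%N -> V i w = (real_var i w)%:E}.
Proof.
have Vge0 : {ae P, forall w, forall i, (1 <= i)%N -> (0 <= V i w)%E}.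
  apply: ae_foralln => -[|i]; first exact: aeW.
  by have := cond_var_ge0 (ltn0Sn i); apply: filterS => w.
have Qfin : {ae P, forall w, forall n, (1 <= n)%N ->
    expeR ((((n%:R^-1)%:E * \sum_(1 <= i < n.+1) V i w) `^ r)%E) \is a fin_num}.
  apply: ae_foralln => -[|n]; first exact: aeW.
  have : P.-integrable [set: T] (fun w =>
      expeR ((((n.+1%:R^-1)%:E * \sum_(1 <= i < n.+2) V i w) `^ r)%E)).
    apply/integrableP; split; first exact: mg.
    under eq_integral do rewrite gee0_abs ?expeR_ge0//.
    by apply: le_lt_trans (momQ (ltn0Sn n)) _; exact: ltry.
  by move=> /(integrable_ae measurableT); apply: filterS => w + _; exact.
apply: filterS2 Vge0 Qfin => w Vw Qw i i1.
have Vi := Vw i i1.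
suff Vy : (V i w < +oo)%E.
  by rewrite /real_var -[in LHS](@fineK _ (V i w)) ?ge0_fin_numE// ger0_norm// fine_ge0.
rewrite ltey; apply/negP => /eqP Voo.
have := Qw i i1; rewrite (_ : (\sum_(1 <= j < i.+1) V j w)%E = +oo%E).
  by rewrite gt0_muley ?lte_fin ?invr_gt0 ?ltr0n// poweRyr// gt_eqF.
case: i i1 {Vi} Voo => // i _ Voo; rewrite big_nat_recr//= Voo addey//.
rewrite gt_eqF// (@lt_le_trans _ _ 0%E)//.
by rewrite big_seq sume_ge0// => j; rewrite mem_index_iota => /andP[j1 _]; exact: Vw.
Qed.

Lemma real_var_ge0 i w : 0 <= real_var i w. Proof. exact: normr_ge0. Qed.

Lemma measurable_wrt_real_var i : (1 <= i)%N -> measurable_wrt (F i.-1) (real_var i).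
Proof.
move=> i1; have [mV _] := ceV i1; have [sF _ _] := filtF.
apply/measurable_wrtP => //; apply: measurableT_comp => //.
by apply: measurableT_comp => //; exact/measurable_wrtP.
Qed.

Lemma integral_real_var i : (1 <= i)%N -> forall A, F i.-1 A ->
  (\int[P]_(w in A) (X i w ^+ 2)%:E <= \int[P]_(w in A) (real_var i w)%:E)%E.
Proof.
move=> i1 A FA; have [_ <-//] := ceV i1.
have [_ Fm _] := filtF; have mA : measurable A := Fm _ _ FA.
rewrite (ae_eq_integral (fun w => (real_var i w)%:E))//.
- by apply: measurable_funTS; exact: measurable_cond_var.
- apply/measurable_EFinP/measurable_funTS.
  exact (measurable_wrt_measurable_fun (Fm i.-1) (measurable_wrt_real_var i1)).
- by apply: filterS cond_var_fin => w Vw _; exact: Vw.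
Qed.

(** Markov's inequality for the exponential moment of the normalized quadratic
    characteristic. *)
Lemma real_var_tail n (u : R) : (1 <= n)%N -> 0 <= u ->
  (P [set w | (n%:R * u < \sum_(1 <= i < n.+1) real_var i w)%R] <=
   (C2 * expR (- (u `^ r)))%:E)%E.
Proof.
move=> n1 u0; apply: exponential_markov (mg n) _ _ _ (momQ n1).
- by move=> w; exact: expeR_ge0.
- apply: measurable_set_lt => //; elim: n {n1} => [|n IH].
    by under eq_fun do rewrite big_geq//; exact: measurable_cst.
  under eq_fun do rewrite big_nat_recr//=.
  apply: measurable_funD => //; have [_ Fm _] := filtF.
  exact (measurable_wrt_measurable_fun (Fm n) (measurable_wrt_real_var (ltn0Sn n))).
- apply: filterS cond_var_fin => w Vw uV.
  have -> : (\sum_(1 <= i < n.+1) V i w = (\sum_(1 <= i < n.+1) real_var i w)%:E)%E.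
    rewrite -sumEFin big_seq [RHS]big_seq; apply: eq_bigr => i.
    by rewrite mem_index_iota => /andP[i1 _]; exact: Vw.
  rewrite -EFinM poweR_EFin/= lee_fin ler_expR ge0_ler_powR ?nnegrE ?(ltW r0)//.
    by rewrite mulr_ge0 ?invr_ge0// sumr_ge0// => i _; exact: real_var_ge0.
  by rewrite mulrC ler_pdivlMr ?ltr0n// mulrC ltW.
Qed.
End conditional_variance.

(** Freedman's inequality at the level z = n x, with truncation at
    y = z^(1 - alpha) and variance threshold n y.  Since
    y^(alpha / (1 - alpha)) = z^alpha, the two moment assumptions give the second
    term by Markov's inequality, and z = z^alpha y simplifies the Gaussian term. *)
Theorem supermartingale_upper_bound (R : realType) (alpha C1 C2 : R)
    d (T : measurableType d) (P : probability T R)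
    (F : nat -> set (set T)) (X : nat -> T -> R) (Q : nat -> T -> \bar R) :
  0 < alpha < 1 ->
  supermartingale_differences P F X ->
  is_quadratic_characteristic P F X Q ->
  exponential_moments P X Q alpha C1 C2 ->
  forall (x : R) (n : nat), 0 < x -> (1 <= n)%N ->
  (P [set w | (n%:R * x <= max_partial_sum X n w)%R]
   <= (expR (- (x `^ (1 + alpha) / (2 * (1 + 3^-1 * x)) * n%:R `^ alpha))
       + (n%:R * C1 + C2) * expR (- (x `^ alpha * n%:R `^ alpha)))%:E)%E.
Proof.
move=> /andP[a0 a1] [[filtF iFX] superX] [V ceV QV] [momX momQ] x n x0 n1.
have [sF Fm _] := filtF.
have iX i : (1 <= i)%N -> P.-integrable [set: T] (EFin \o X i) by move=> /iFX[].
have FX i : (1 <= i)%N -> measurable_wrt (F i) (X i) by move=> /iFX[].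
have mX i : (1 <= i)%N -> measurable_fun [set: T] (X i).
  by move=> i1; apply/measurable_EFinP; exact: (measurable_int P (iX i i1)).
have a1' : 0 < 1 - alpha by rewrite subr_gt0.
pose r := alpha / (1 - alpha).
have r0 : 0 < r by rewrite divr_gt0.
have momV k : (1 <= k)%N ->
    (\int[P]_w expeR ((((k%:R^-1)%:E * \sum_(1 <= i < k.+1) V i w) `^ r)%E) <= C2%:E)%E.
  by move=> k1; have := momQ k k1; under eq_integral do rewrite QV.
have nR : 0 < n%:R :> R by rewrite ltr0n.
pose z := n%:R * x; have z0 : 0 < z by rewrite mulr_gt0.
(* Truncating at this y, and the quadratic characteristic at n y, makes both
   Markov bounds decay like exp (- z^alpha). *)
pose y := z `^ (1 - alpha); have y0 : 0 < y by rewrite powR_gt0.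
have yr : y `^ r = x `^ alpha * n%:R `^ alpha.
  rewrite /y -powRrM mulrC divfK ?gt_eqF// /z mulrC powRM// ltW//.
have zE : z `^ alpha * y = z.
  rewrite /y -powRD; last by rewrite (gt_eqF z0) implybT.
  by rewrite addrC subrK powRr1// ltW.
have superX' i : (1 <= i)%N -> forall A, F i.-1 A ->
    (\int[P]_(w in A) (Num.max (X i w) 0)%:E <=
     \int[P]_(w in A) (Num.max (- X i w) 0)%:E)%E.
  move=> i1; have [Y YX Y0] := superX i i1.
  exact: (supermartingale_difference_pos_le_neg (Fm i.-1) (iX i i1) YX Y0).
have := @freedman_max _ _ _ P F X (real_var V) filtF iX FX superX'
  (measurable_wrt_real_var filtF ceV) (real_var_ge0 V)
  (integral_real_var filtF ceV r0 momV) y z (n%:R * y) n z0 (ltW y0)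
  (mulr_gt0 nR y0) n1.
move=> /le_trans; apply; rewrite EFinD; apply: leeD.
  rewrite lee_fin ler_expR lerN2 le_eqVlt; apply/orP; left; apply/eqP.
  have -> : x `^ (1 + alpha) / (2 * (1 + 3^-1 * x)) * n%:R `^ alpha =
      x * z `^ alpha / (2 * (1 + x / 3)).
    rewrite powRD ?(gt_eqF x0) ?implybT// powRr1 ?(ltW x0)//.
    by rewrite /z powRM ?ltW//; field; lra.
  have -> : z ^+ 2 = z `^ alpha * y * (n%:R * x) by rewrite zE expr2.
  have nyx : 0 < y * (n%:R * x) by rewrite !mulr_gt0.
  have ny3 : 0 < n%:R * y * 3 by rewrite !mulr_gt0.
  by rewrite {3}/z; field; rewrite !gt_eqF// addr_gt0.
rewrite -yr mulrDl EFinD; apply: leeD; last first.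
  exact: (real_var_tail filtF ceV r0 momV n1 (ltW y0)).
apply: (@le_trans _ _ (\sum_(1 <= i < n.+1) (C1 * expR (- (y `^ r)))%:E)%E).
  rewrite big_seq [leRHS]big_seq; apply: lee_sum => i.
  rewrite mem_index_iota => /andP[i1 _].
  apply: (@exponential_markov _ _ _ P
    (fun w => (expR (Num.max (X i w) 0 `^ r))%:E)).
  - apply/measurable_EFinP; apply: measurableT_comp => //.
    apply: (measurableT_comp (measurable_powR _)).
    by apply: measurable_maxr => //; exact: mX.
  - by move=> w; rewrite lee_fin expR_ge0.
  - by apply: measurable_set_lt => //; exact: mX.
  - apply: aeW => w /= yX.
    rewrite lee_fin ler_expR ge0_ler_powR ?nnegrE ?(ltW r0) ?(ltW y0)//.
      by rewrite le_max lexx orbT.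
    by rewrite le_max (ltW yX).
  - by have := momX i i1; rewrite unlock.
rewrite sumEFin lee_fin sumr_const_nat subSS subn0 -mulrA mulr_natl.
exact: lexx.
Qed.

(** * The order of the upper bound at x = 1 *)

Lemma powR_nat_ge1 (R : realType) (a : R) n : 0 <= a -> (1 <= n)%N -> 1 <= n%:R `^ a :> R.
Proof.
move=> a0 n1; rewrite -[leLHS](powRr0 n%:R); apply: ler_powR => //.
by rewrite ler1n.
Qed.

Lemma le_expR_powR (R : realType) (c a : R) : 0 < c -> 0 < a ->
  exists2 M : R, 0 < M & forall x, 0 <= x -> x <= M * expR (c * x `^ a).
Proof.
move=> c0 a0; (* For x >= 1 this gives x <= (x^a)^m, one term of the exponential series. *)
pose m := (Num.truncn (a^-1)).+1.
have am : 1 <= a * m%:R.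
  rewrite -ler_pdivrMl// mulr1 ltW//.
  by have /truncn_itv/andP[] : 0 <= a^-1 by rewrite invr_ge0 ltW.
have M0 : 0 < m`!%:R / c ^+ m by rewrite divr_gt0 ?exprn_gt0// ltr0n fact_gt0.
exists (1 + m`!%:R / c ^+ m) => [|x x0]; first by rewrite addr_gt0.
have cx0 : 0 <= c * x `^ a by rewrite mulr_ge0 ?(ltW c0) ?powR_ge0.
rewrite mulrDl mul1r; have [x1|x1] := leP x 1.
  apply: (le_trans x1); rewrite -[leLHS]addr0 lerD//.
    by rewrite -[leLHS]expR0 ler_expR.
  by rewrite mulr_ge0 ?(ltW M0) ?expR_ge0.
apply: (@le_trans _ _ ((x `^ a) ^+ m)).
  rewrite -powR_mulrn ?powR_ge0// -powRrM -[leLHS]powRr1//.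
  by apply: ler_powR => //; exact: ltW.
rewrite -[leLHS]add0r lerD ?expR_ge0//.
rewrite mulrAC ler_pdivlMr ?exprn_gt0// -exprMn [X in X ^+ _]mulrC.
rewrite -ler_pdivrMl ?ltr0n ?fact_gt0//.
have := @expR_ge1Dxn _ (c * x `^ a) m.-1.
rewrite cx0 => /(_ isT); rewrite prednK//.
by apply: le_trans; lra.
Qed.

(** The upper bound at x = 1, where n exp (- 5/8 n^alpha) stays bounded. *)
Theorem supermartingale_bigO (R : realType) (alpha C1 C2 : R) :
  0 < alpha < 1 -> 0 < C1 -> 0 < C2 ->
  exists K : R, 0 < K /\
  forall (d : measure_display) (T : measurableType d) (P : probability T R)
    (F : nat -> set (set T)) (X : nat -> T -> R) (Q : nat -> T -> \bar R),
  supermartingale_differences P F X ->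
  is_quadratic_characteristic P F X Q ->
  exponential_moments P X Q alpha C1 C2 ->
  bigO_with K (fun n => fine (P [set w | (n%:R <= max_partial_sum X n w)%R]))
              (fun n => expR (- (3 / 8 * n%:R `^ alpha))).
Proof.
move=> a01 C10 C20; have /andP[a0 a1] := a01.
have c0 : 0 < 5 / 8 :> R by lra.
have [M M0 nM] := le_expR_powR c0 a0.
have K0 : 0 < 1 + M * C1 + C2 by rewrite !addr_gt0// mulr_gt0.
exists (1 + M * C1 + C2); split=> // d T P F X Q smX qQ momX n n1.
have := supermartingale_upper_bound a01 smX qQ momX ltr01 n1.
rewrite mulr1 !powR1 !mul1r mulr1.
set E := [set w | _]; set N := n%:R `^ alpha => PE.
have PEfin : P E \is a fin_num.
  rewrite ge0_fin_numE ?measure_ge0//; exact: le_lt_trans PE (ltry _).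
rewrite ger0_norm ?fine_ge0 ?measure_ge0// ger0_norm ?expR_ge0//.
move: PE; rewrite -[P E]fineK// lee_fin => /le_trans; apply.
have -> : (2 * (1 + 3^-1))^-1 * N = 3 / 8 * N by field.
(* 3/8 is the value of 1 / (2 (1 + 1/3)); the remaining 5/8 of the faster
   exponential absorbs the factor n. *)
have -> : - N = - (3 / 8 * N) + - (5 / 8 * N) by field.
rewrite expRD; set e := expR (- (3 / 8 * N)); set f := expR _.
have e0 : 0 < e by exact: expR_gt0.
have N1 : 1 <= N by rewrite powR_nat_ge1 ?ltW.
have f1 : f <= 1 by rewrite expR_le1; lra.
have nf : n%:R * f <= M.
  by rewrite /f expRN ler_pdivrMr ?expR_gt0 ?nM.
have C1f := ler_wpM2l (ltW C10) nf.
have C2f := ler_wpM2l (ltW C20) f1.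
have := @ler_wpM2r _ e (ltW e0) (1 + (n%:R * C1 + C2) * f) (1 + M * C1 + C2).
by move=> H; apply: le_trans (H _); [lra|lra].
Qed.

(** * Fair coins from the binary digits of a uniform variable *)

Section coin_tossing.
Context {R : realType}.
Implicit Types (u v c : R) (A B : set R).

(** A uniform variable on [0, 1] carries an infinite sequence of fair coins, its
    binary digits. *)
Definition unif : probability (measurableTypeR R) R := uniform_prob (@ltr01 R).

Lemma unifE A : measurable A ->
  unif A = lebesgue_measure (A `&` `[0, 1[%classic).
Proof.
move=> mA; rewrite /unif/= /uniform_prob integral_uniform_pdf.
rewrite (eq_integral (cst 1%E)); last first.
  move=> x; rewrite inE => -[_]; rewrite /= in_itv/= => x01.
  by rewrite /uniform_pdf x01 subr0 invr1.
rewrite integral_cst ?mul1e; last exact: measurableI.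
rewrite (_ : A `&` `[0, 1] = (A `&` `[0, 1[) `|` (A `&` [set 1])); last first.
  rewrite -setIUr; congr (_ `&` _); apply/seteqP; split=> x /=; rewrite !in_itv/=.
    by move=> /andP[->]; rewrite le_eqVlt => /predU1P[->|->]; [right|left].
  by move=> [/andP[-> /ltW//]|->]; rewrite ler01 lexx.
rewrite measureU0//; try exact: measurableI.
apply/eqP; rewrite eq_le measure_ge0 andbT -(lebesgue_measure_set1 (1 : R)).
by apply: le_measure; rewrite ?inE//; exact: measurableI.
Qed.

Lemma unif_eq A B : measurable A -> measurable B ->
  (forall u, 0 <= u < 1 -> A u <-> B u) -> unif A = unif B.
Proof.
move=> mA mB AB; rewrite !unifE//; congr (lebesgue_measure _).
by apply/seteqP; split=> x /= [+ x01]; move: (x01); rewrite in_itv/= => /AB => -[a b] /=;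
  split => //; [exact: a|exact: b].
Qed.

(** The number in [0, 1[ whose binary expansion is c followed by that of v. *)
Definition put_digit c v := (c + v) / 2.

Lemma measurable_put_digit c : measurable_fun [set: R] (put_digit c).
Proof. by apply: measurable_funM => //; exact: measurable_funD. Qed.

Lemma lebesgue_put_digit c B : measurable B ->
  lebesgue_measure (B : set (measurableTypeR R)) =
  (2^-1%:E * lebesgue_measure (put_digit c @^-1` B : set (measurableTypeR R)))%E.
Proof.
move=> mB.
have h0 : 0 <= 2^-1 :> R by [].
apply: (@lebesgue_measure_unique R (mscale (NngNum h0)
  (pushforward lebesgue_measure (put_digit c : measurableTypeR R -> measurableTypeR R)))) => //.
  exact: measurable_put_digit.
move=> mp _ [[a b] _ <-]; rewrite /= /mscale/= /pushforward/=.
rewrite (_ : _ @^-1` _ = `]2 * a - c, 2 * b - c]%classic); last first.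
  apply/seteqP; split=> x /=; rewrite !in_itv/= /put_digit => /andP[? ?]; apply/andP; split; lra.
rewrite !lebesgue_measure_itv/= !lte_fin.
have -> : (2 * a - c < 2 * b - c) = (a < b) by apply/idP/idP; lra.
case: ifPn => _; last by rewrite mule0.
by rewrite -!EFinB -EFinM; congr EFin; field.
Qed.

(** The first digit is fair and independent of the remaining ones, which are
    again uniform: every fact about the coins below follows from this identity
    by induction on the number of digits. *)
Lemma unif_put_digit A : measurable A ->
  unif A = (2^-1%:E * unif (put_digit 0 @^-1` A) + 2^-1%:E * unif (put_digit 1 @^-1` A))%E.
Proof.
move=> mA.
have mp c : measurable (put_digit c @^-1` A).
  by rewrite -[X in measurable X]setTI; exact: measurable_put_digit.
rewrite !unifE//.
rewrite (_ : A `&` _ = (A `&` `[0, 2^-1[) `|` (A `&` `[2^-1, 1[)); last first.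
  rewrite -setIUr; congr (_ `&` _); apply/seteqP; split=> x /=; rewrite !in_itv/=.
    by move=> /andP[x0 x1]; have [?|?] := ltP x 2^-1; [left|right]; rewrite ?x0.
  by move=> [|] /andP[x0 x1]; apply/andP; split; lra.
rewrite measureU; try exact: measurableI; last first.
  apply/seteqP; split=> x //= [[_ +] [_]]; rewrite !in_itv/=; lra.
transitivity (2^-1%:E * lebesgue_measure (put_digit 0 @^-1` (A `&` `[0, 2^-1[)%R) +
              2^-1%:E * lebesgue_measure (put_digit 1 @^-1` (A `&` `[2^-1, 1[)%R))%E.
  by congr (_ + _)%E; apply: lebesgue_put_digit; exact: measurableI.
rewrite !preimage_setI; congr (_ * lebesgue_measure (_ `&` _) + _ * lebesgue_measure (_ `&` _))%E.
  apply/seteqP; split=> x /=; rewrite !in_itv/= /put_digit => /andP[? ?]; apply/andP; split; lra.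
apply/seteqP; split=> x /=; rewrite !in_itv/= /put_digit => /andP[? ?]; apply/andP; split; lra.
Qed.

(** The first binary digit of u, coded as a sign.  The value 0 off [0, 1[ makes
    the relations with flip hold everywhere and not only almost everywhere. *)
Definition digit u : R :=
  if 0 <= u < 2^-1 then 1 else if 2^-1 <= u < 1 then -1 else 0.

(** The doubling map on [0, 1[, extended by the identity. *)
Definition shift u : R :=
  if 0 <= u < 2^-1 then 2 * u else if 2^-1 <= u < 1 then 2 * u - 1 else u.

(** The involution of [0, 1[ that reverses the digit of rank j. *)
Fixpoint flip (j : nat) u : R :=
  if 0 <= u < 2^-1 then
    if j is k.+1 then put_digit 0 (flip k (2 * u)) else put_digit 1 (2 * u)
  else if 2^-1 <= u < 1 then
    if j is k.+1 then put_digit 1 (flip k (2 * u - 1))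
    else put_digit 0 (2 * u - 1)
  else u.

(** Every point of [0, 1[ is a digit put in front of another point of [0, 1[,
    which reduces the identities on digits to computation. *)
Variant digit_spec u : Prop :=
| FirstDigit0 v of 0 <= v < 1 & u = put_digit 0 v
| FirstDigit1 v of 0 <= v < 1 & u = put_digit 1 v
| NoDigit of (0 <= u < 2^-1) = false & (2^-1 <= u < 1) = false.

Lemma digitP u : digit_spec u.
Proof.
have [/andP[u0 u1]|nu] := boolP (0 <= u < 1); last first.
  by apply: NoDigit; apply/negP => /andP[? ?]; move: nu => /negP; apply; apply/andP; split; lra.
have [u2|u2] := ltP u 2^-1.
  by apply: (@FirstDigit0 _ (2 * u)); [lra|rewrite /put_digit; lra].
by apply: (@FirstDigit1 _ (2 * u - 1)); [lra|rewrite /put_digit; lra].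
Qed.

Lemma put_digit0_itv v : 0 <= v < 1 -> (0 <= put_digit 0 v < 2^-1) = true.
Proof. by rewrite /put_digit; lra. Qed.

Lemma put_digit1_itv v : 0 <= v < 1 ->
  (0 <= put_digit 1 v < 2^-1) = false /\ (2^-1 <= put_digit 1 v < 1) = true.
Proof.
rewrite /put_digit => v01; split; last lra.
by apply/negbTE/negP; lra.
Qed.

Lemma digit_put0 v : 0 <= v < 1 -> digit (put_digit 0 v) = 1.
Proof. by move=> v01; rewrite /digit put_digit0_itv. Qed.

Lemma digit_put1 v : 0 <= v < 1 -> digit (put_digit 1 v) = -1.
Proof. by move=> /put_digit1_itv[v1 v2]; rewrite /digit v1 v2. Qed.

Lemma shift_put0 v : 0 <= v < 1 -> shift (put_digit 0 v) = v.
Proof. by move=> v01; rewrite /shift put_digit0_itv// /put_digit; field. Qed.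

Lemma shift_put1 v : 0 <= v < 1 -> shift (put_digit 1 v) = v.
Proof. by move=> /put_digit1_itv[v1 v2]; rewrite /shift v1 v2 /put_digit; field. Qed.

Lemma flip_put0 j v : 0 <= v < 1 -> flip j (put_digit 0 v) =
  if j is k.+1 then put_digit 0 (flip k v) else put_digit 1 v.
Proof.
have E : 2 * put_digit 0 v = v by rewrite /put_digit; field.
by move=> v01; case: j => [|j] /=; rewrite put_digit0_itv// E.
Qed.

Lemma flip_put1 j v : 0 <= v < 1 -> flip j (put_digit 1 v) =
  if j is k.+1 then put_digit 1 (flip k v) else put_digit 0 v.
Proof.
have E : 2 * put_digit 1 v - 1 = v by rewrite /put_digit; field.
by move=> /put_digit1_itv[v1 v2]; case: j => [|j] /=; rewrite v1 v2 E.
Qed.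

Lemma flip_itv j v : 0 <= v < 1 -> 0 <= flip j v < 1.
Proof.
elim: j v => [|j IH] v v01; case: (digitP v) => [u u01 ->|u u01 ->|v1 v2].
- by rewrite flip_put0// /put_digit; lra.
- by rewrite flip_put1// /put_digit; lra.
- by move/negbT: v2; move/negbT: v1; lra.
- by rewrite flip_put0// /put_digit; have := IH u u01; lra.
- by rewrite flip_put1// /put_digit; have := IH u u01; lra.
- by move/negbT: v2; move/negbT: v1; lra.
Qed.

Lemma digit_flip0 u : digit (flip 0 u) = - digit u.
Proof.
case: (digitP u) => [v v01 ->|v v01 ->|u1 u2].
- by rewrite flip_put0// digit_put1// digit_put0.
- by rewrite flip_put1// digit_put1// digit_put0// opprK.
- by rewrite /= u1 u2 /digit u1 u2 oppr0.
Qed.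

Lemma digit_flipS j u : digit (flip j.+1 u) = digit u.
Proof.
case: (digitP u) => [v v01 ->|v v01 ->|u1 u2].
- by rewrite flip_put0// !digit_put0// flip_itv.
- by rewrite flip_put1// !digit_put1// flip_itv.
- by rewrite /= u1 u2.
Qed.

Lemma shift_flipS j u : shift (flip j.+1 u) = flip j (shift u).
Proof.
case: (digitP u) => [v v01 ->|v v01 ->|u1 u2].
- by rewrite flip_put0// !shift_put0// flip_itv.
- by rewrite flip_put1// !shift_put1// flip_itv.
- by rewrite /= u1 u2 /shift u1 u2; case: j => [|j]/=; rewrite u1 u2.
Qed.

Arguments flip : simpl never.

Definition coin (k : nat) u : R := digit (iter k shift u).

Lemma coinS k u : coin k.+1 u = coin k (shift u).
Proof. by rewrite /coin iterSr. Qed.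

Lemma coin_flip k u : coin k (flip k u) = - coin k u.
Proof.
elim: k u => [|k IH] u; first exact: digit_flip0.
by rewrite !coinS shift_flipS IH.
Qed.

Lemma coin_flip_lt j k u : (k < j)%N -> coin k (flip j u) = coin k u.
Proof.
elim: k j u => [|k IH] [|j] u //; first by rewrite /coin/= digit_flipS.
by rewrite ltnS => kj; rewrite !coinS shift_flipS IH.
Qed.

Lemma normr_coin_le1 k u : `|coin k u| <= 1.
Proof.
by rewrite /coin /digit; case: ifP => _; [|case: ifP => _]; rewrite ?normrN1 ?normr1 ?normr0.
Qed.

Let measurable_first_half : measurable_fun [set: R] (fun u : R => 0 <= u < 2^-1).
Proof.
by apply: measurable_and; [exact: measurable_fun_ler|exact: measurable_fun_ltr].
Qed.

Let measurable_second_half : measurable_fun [set: R] (fun u : R => 2^-1 <= u < 1).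
Proof.
by apply: measurable_and; [exact: measurable_fun_ler|exact: measurable_fun_ltr].
Qed.

Let measurable_double : measurable_fun [set: R] (fun u : R => 2 * u).
Proof. exact: measurable_funM. Qed.

Let measurable_doubleB1 : measurable_fun [set: R] (fun u : R => 2 * u - 1).
Proof. exact: measurable_funB. Qed.

Lemma measurable_digit : measurable_fun [set: R] digit.
Proof. by apply: measurable_fun_ifT => //; exact: measurable_fun_ifT. Qed.

Lemma measurable_shift : measurable_fun [set: R] shift.
Proof. by apply: measurable_fun_ifT => //; exact: measurable_fun_ifT. Qed.

Lemma measurable_flip j : measurable_fun [set: R] (flip j).
Proof.
elim: j => [|j IH]; apply: measurable_fun_ifT => //; try apply: measurable_fun_ifT => //;
  apply: (measurableT_comp (measurable_put_digit _)) => //; exact: measurableT_comp.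
Qed.

Lemma measurable_iter_shift k : measurable_fun [set: R] (iter k shift).
Proof.
elim: k => [|k IH]; first exact: measurable_id.
exact: (measurableT_comp measurable_shift).
Qed.

Lemma measurable_coin k : measurable_fun [set: R] (coin k).
Proof. exact: measurableT_comp measurable_digit (measurable_iter_shift k). Qed.

Let measurable_preimage (f : R -> R) A : measurable_fun [set: R] f -> measurable A ->
  measurable (f @^-1` A).
Proof. by move=> mf mA; rewrite -[X in measurable X]setTI; exact: mf. Qed.

Lemma unif_shift A : measurable A -> unif (shift @^-1` A) = unif A.
Proof.
move=> mA; rewrite unif_put_digit; last exact: measurable_preimage measurable_shift mA.
have E c : (forall v, 0 <= v < 1 -> shift (put_digit c v) = v) ->
    unif (put_digit c @^-1` (shift @^-1` A)) = unif A.
  move=> cE; apply: unif_eq => //.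
    apply: measurable_preimage (measurable_put_digit c) _.
    exact: measurable_preimage measurable_shift mA.
  by move=> u u01; rewrite /preimage/= cE.
rewrite !E; [|exact: shift_put1|exact: shift_put0].
have Afin : unif A \is a fin_num by exact: fin_num_measure.
by rewrite -(fineK Afin) -!EFinM -EFinD; congr EFin; field.
Qed.

Lemma unif_flip j A : measurable A -> unif (flip j @^-1` A) = unif A.
Proof.
have mflip j' B : measurable B -> measurable (flip j' @^-1` B).
  by move=> mB; exact: measurable_preimage (measurable_flip j') mB.
have mput c B : measurable B -> measurable (put_digit c @^-1` B).
  by move=> mB; exact: measurable_preimage (measurable_put_digit c) mB.
elim: j A => [|j IH] A mA; rewrite unif_put_digit; try exact: mflip.
  rewrite [RHS]unif_put_digit// addeC.
  congr (_ * _ + _ * _)%E; apply: unif_eq; try by do ?[apply: mput|apply: mflip].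
    by move=> u u01; rewrite /preimage/= flip_put1.
  by move=> u u01; rewrite /preimage/= flip_put0.
rewrite [RHS]unif_put_digit//; congr (_ * _ + _ * _)%E.
  rewrite -[RHS]IH; last exact: mput.
  apply: unif_eq; try by do ?[apply: mput|apply: mflip].
  by move=> u u01; rewrite /preimage/= flip_put0.
rewrite -[RHS]IH; last exact: mput.
apply: unif_eq; try by do ?[apply: mput|apply: mflip].
by move=> u u01; rewrite /preimage/= flip_put1.
Qed.

Definition walk (n : nat) u : R := \sum_(0 <= k < n) coin k u.

Lemma measurable_walk n : measurable_fun [set: R] (walk n).
Proof. by apply: measurable_sum => k; exact: measurable_coin. Qed.

Lemma walkS n u : walk n.+1 u = digit u + walk n (shift u).
Proof.
rewrite /walk big_nat_recl//=; congr (_ + _).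
by apply: eq_bigr => k _; rewrite coinS.
Qed.

(** Conditioning on the first digit gives Pascal's recursion.  Equality holds,
    but the lower bound alone avoids discussing the values outside the range of
    the walk. *)
Lemma walk_binomial_ge n k :
  ((('C(n, k))%:R / 2 ^+ n)%:E <= unif (walk n @^-1` [set (n%:R - 2 * k%:R)%R]))%E.
Proof.
elim: n k => [|n IH] k.
  case: k => [|k]; last by rewrite bin0n mul0r measure_ge0.
  rewrite bin0 expr0 divr1 mulr0 subr0 (_ : _ @^-1` _ = setT) ?probability_setT//.
  by apply/seteqP; split=> // u _; rewrite /= /walk big_geq.
have mw m x : measurable (walk m @^-1` [set x]).
  exact: measurable_preimage (measurable_walk m) (measurable_set1 x).
have mput c B : measurable B -> measurable (put_digit c @^-1` B).
  by move=> mB; exact: measurable_preimage (measurable_put_digit c) mB.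
rewrite unif_put_digit; last exact: mw.
have E0 x : unif (put_digit 0 @^-1` (walk n.+1 @^-1` [set x])) =
            unif (walk n @^-1` [set x - 1]).
  apply: unif_eq; [exact: (mput _ _ (mw _ _))|exact: mw|] => u u01.
  rewrite /preimage/= walkS digit_put0// shift_put0//.
  by rewrite /set1/=; split=> H; lra.
have E1 x : unif (put_digit 1 @^-1` (walk n.+1 @^-1` [set x])) =
            unif (walk n @^-1` [set x + 1]).
  apply: unif_eq; [exact: (mput _ _ (mw _ _))|exact: mw|] => u u01.
  rewrite /preimage/= walkS digit_put1// shift_put1//.
  by rewrite /set1/=; split=> H; lra.
rewrite E0 E1; case: k => [|k].
  rewrite bin0.
  apply: (@le_trans _ _ (2^-1%:E * unif (walk n @^-1` [set (n.+1%:R - 2 * 0%:R - 1)%R]))%E).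
    have -> : n.+1%:R - 2 * 0%:R - 1 = n%:R - 2 * 0%:R :> R by rewrite -natr1; ring.
    apply: le_trans (lee_wpmul2l _ (IH 0%N)); last by rewrite lee_fin.
    by rewrite bin0 -EFinM lee_fin exprS invfM mulrCA.
  by rewrite leeDl// mule_ge0// lee_fin.
have -> : n.+1%:R - 2 * k.+1%:R - 1 = n%:R - 2 * k.+1%:R :> R by rewrite -(natr1 n); ring.
have -> : n.+1%:R - 2 * k.+1%:R + 1 = n%:R - 2 * k%:R :> R by rewrite -(natr1 n) -(natr1 k); ring.
have h2 : (0 <= 2^-1%:E :> \bar R)%E by rewrite lee_fin.
apply: le_trans (leeD (lee_wpmul2l h2 (IH k.+1)) (lee_wpmul2l h2 (IH k))).
rewrite -!EFinM -EFinD lee_fin binS natrD exprS invfM.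
by rewrite le_eqVlt; apply/orP; left; apply/eqP; ring.
Qed.
End coin_tossing.

(** * A lower bound for binomial coefficients *)

Lemma bin_le_half n i : ('C(n, i) <= 'C(n, n./2))%N.
Proof.
have low j : (j <= n./2)%N -> ('C(n, j) <= 'C(n, n./2))%N.
  move=> jn; rewrite -(subKn jn); elim: (n./2 - j)%N => [|e IH]; first by rewrite subn0.
  have [en|ne] := ltnP e n./2; last by rewrite (_ : n./2 - e.+1 = n./2 - e)%N//; lia.
  apply: leq_trans IH; have -> : (n./2 - e = (n./2 - e.+1).+1)%N by lia.
  set m := (n./2 - e.+1)%N.
  have mn : (m.+1 <= n - m)%N by rewrite /m; have := odd_double_half n; lia.
  rewrite -(leq_pmul2l (ltn0Sn m)) mul_bin_left.
  by rewrite leq_mul2r mn orbT.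
have [/low//|hi] := leqP i n./2.
have [ni|ni] := leqP i n; last by rewrite bin_small.
by rewrite -bin_sub//; apply: low; have := odd_double_half n; lia.
Qed.

Lemma expn2_le_bin_half n : (2 ^ n <= n.+1 * 'C(n, n./2))%N.
Proof.
rewrite -[2%N]/(1 + 1)%N expnDn.
under eq_bigr do rewrite !exp1n !muln1.
apply: (@leq_trans (\sum_(i < n.+1) 'C(n, n./2))%N).
  by apply: leq_sum => i _; exact: bin_le_half.
by rewrite sum_nat_const card_ord.
Qed.

(** The ratio of the coefficients of ranks i and i + 1 is (i + 1) / (n - i), which
    is at least (k + 1) / (n - k) for i >= k. *)
Lemma bin_ratio_le n k e :
  ('C(n, k + e) * k.+1 ^ e <= 'C(n, k) * (n - k) ^ e)%N.
Proof.
elim: e => [|e IH]; first by rewrite addn0.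
rewrite !expnSr addnS.
apply: (@leq_trans ('C(n, k + e) * k.+1 ^ e * (n - k))%N); last first.
  by rewrite mulnA leq_mul2r IH orbT.
have H : (k.+1 * 'C(n, (k + e).+1) <= (n - k) * 'C(n, k + e))%N.
  apply: (@leq_trans ((k + e).+1 * 'C(n, (k + e).+1))%N).
    by rewrite leq_mul2r ltnS leq_addr orbT.
  by rewrite mul_bin_left leq_mul2r leq_sub2l ?orbT// leq_addr.
have := leq_mul (leqnn (k.+1 ^ e)) H; lia.
Qed.

(** Comparison with the central coefficient, which is at least 2^n / (n + 1): it is
    at most n./2 - k ratios away, and each ratio is at least
    exp (- (n - 2 k) / (k + 1)). *)
Lemma bin_lower_bound (R : realType) n k : (k.*2 <= n)%N ->
  expR (- ((n%:R - 2 * k%:R) ^+ 2 / (2 * k.+1%:R))) / n.+1%:R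
    <= 'C(n, k)%:R / 2 ^+ n :> R.
Proof.
move=> kn.
have kR : 2 * k%:R <= n%:R :> R by rewrite -natrM ler_nat mul2n.
have k0 : 0 <= k%:R :> R by rewrite ler0n.
(* Number of steps from k to the central coefficient. *)
pose e := (n./2 - k)%N.
have eR : 2 * e%:R <= n%:R - 2 * k%:R :> R.
  rewrite lerBrDr -!natrM -natrD ler_nat /e; have := odd_double_half n; lia.
have := bin_ratio_le n k e.
have -> : (k + e = n./2)%N by rewrite /e; have := odd_double_half n; lia.
rewrite -(ler_nat R) !natrM !natrX natrB; last by lia.
have := expn2_le_bin_half n; rewrite -(ler_nat R) natrM natrX.
set c := 'C(n, n./2)%:R; set x := 'C(n, k)%:R => nc cx.
have k1 : 0 < k.+1%:R :> R by rewrite ltr0n.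
have n1 : 0 < n.+1%:R :> R by rewrite ltr0n.
pose t : R := (n%:R - 2 * k%:R) ^+ 2 / (2 * k.+1%:R).
have H : (n%:R - k%:R) ^+ e <= expR t * k.+1%:R ^+ e.
  rewrite -ler_pdivrMr ?exprn_gt0// -exprVn -exprMn.
  apply: (@le_trans _ _ (expR ((n%:R - 2 * k%:R) / k.+1%:R) ^+ e)).
    rewrite lerXn2r ?nnegrE ?expR_ge0//.
      by rewrite divr_ge0 ?ler0n// subr_ge0; lra.
    apply: le_trans (expR_ge1Dx _).
    rewrite ler_pdivrMr// mulrDl mul1r divfK ?gt_eqF// -(natr1 k); lra.
  rewrite -expRM_natl ler_expR /t expr2 -mulrA.
  have -> : (n%:R - 2 * k%:R) * ((n%:R - 2 * k%:R) / (2 * k.+1%:R)) =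
     (n%:R - 2 * k%:R) / 2 * ((n%:R - 2 * k%:R) / k.+1%:R) :> R by field; lra.
  by rewrite ler_wpM2r//; [rewrite divr_ge0// ?ler0n// subr_ge0|lra].
have x0 : 0 <= x by rewrite ler0n.
have cxt : c <= x * expR t.
  rewrite -(ler_pM2r (exprn_gt0 e k1)) (le_trans cx)// -mulrA.
  exact: ler_wpM2l.
rewrite -/t expRN ler_pdivlMr ?exprn_gt0//.
have E0 := expR_gt0 t.
apply: le_trans (ler_wpM2l _ nc) _; first by rewrite divr_ge0 ?invr_ge0 ?ltW.
have -> : (expR t)^-1 / n.+1%:R * (n.+1%:R * c) = (expR t)^-1 * c.
  by field; rewrite !gt_eqF.
by rewrite ler_pdivrMl// mulrC.
Qed.

(** * Moderate deviations of the simple random walk from below *)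

Lemma powR_nat_near_ge (R : realType) (b c : R) : 0 < b ->
  \forall n \near \oo, c <= n%:R `^ b.
Proof.
move=> b0; near=> n.
have [c0|c0] := leP c 0; first by rewrite (le_trans c0)// powR_ge0.
have : c `^ b^-1 <= n%:R by near: n; exact: nbhs_infty_ger.
move=> /(ge0_ler_powR (ltW b0)); rewrite !nnegrE powR_ge0 ler0n => /(_ isT isT).
by rewrite -powRrM mulVf ?gt_eqF// powRr1// ltW.
Unshelve. all: by end_near. Qed.

Lemma natS_le_expR_powR_near (R : realType) (a c : R) : 0 < a -> 0 < c ->
  \forall n \near \oo, n.+1%:R <= expR (c * n%:R `^ a).
Proof.
move=> a0 c0; have c20 : 0 < c / 2 by rewrite divr_gt0.
have [M M0 HM] := le_expR_powR c20 a0.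
near=> n.
have n1 : 1 <= n%:R :> R by near: n; exact: nbhs_infty_ger.
have : 4 * M / c <= n%:R `^ a by near: n; exact: powR_nat_near_ge.
set N := n%:R `^ a => cN.
have nM : n%:R <= M * expR (c / 2 * N) by apply: HM; rewrite ler0n.
have M2 : 2 * M <= expR (c / 2 * N).
  apply: le_trans (expR_ge1Dx _).
  by move: cN; rewrite ler_pdivrMr//; lra.
have -> : c * N = c / 2 * N + c / 2 * N by field.
rewrite expRD -natr1.
have := ler_wpM2r (expR_ge0 (c / 2 * N)) M2; lra.
Unshelve. all: by end_near. Qed.

(** The sharp constant is 1/2, but 3/2 is what the scale of the example leaves
    below 3, so the crude binomial bound suffices.  The single value n - 2 k of
    the walk just above the threshold already has enough mass. *)
Lemma walk_tail_lower_bound (R : realType) (alpha : R) : 0 < alpha < 1 ->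
  \forall n \near \oo, ((expR (- (3 / 2 * n%:R `^ alpha)))%:E <=
    unif [set u : R | (n%:R `^ ((1 + alpha) / 2) <= walk n u)%R])%E.
Proof.
move=> /andP[a0 a1]; near=> n.
have n0 : 0 < n%:R :> R.
  by apply: (@lt_le_trans _ _ 1) => //; near: n; exact: nbhs_infty_ger.
(* With t the exponent of the binomial bound, t <= (a + 2)^2 / (n - a).  The
   thresholds 20 and 50 give (a + 2)^2 <= 1.21 n N and n - a >= 0.98 n, hence
   t <= 5/4 N; the last quarter of N pays for the factor n + 1. *)
have a20 : 20 <= n%:R `^ ((1 + alpha) / 2) by near: n; apply: powR_nat_near_ge; lra.
have n1N : n.+1%:R <= expR (4^-1 * n%:R `^ alpha).
  by near: n; apply: natS_le_expR_powR_near.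
set a := n%:R `^ ((1 + alpha) / 2) in a20 *; set N := n%:R `^ alpha in n1N *.
have N0 : 0 < N by rewrite powR_gt0.
have an : 50 * a <= n%:R.
  have : 50 <= n%:R `^ ((1 - alpha) / 2) by near: n; apply: powR_nat_near_ge; lra.
  move=> /(@ler_wpM2r _ a); rewrite -powRD; last by rewrite (gt_eqF n0) implybT.
  rewrite (_ : (1 - alpha) / 2 + (1 + alpha) / 2 = 1); last by field.
  by rewrite powRr1 ?(ltW n0)//; apply; lra.
have a2 : a ^+ 2 = n%:R * N.
  rewrite expr2 -powRD; last by rewrite (gt_eqF n0) implybT.
  rewrite (_ : (1 + alpha) / 2 + (1 + alpha) / 2 = 1 + alpha); last by field.
  rewrite powRD; last by rewrite (gt_eqF n0) implybT.
  by rewrite powRr1 ?(ltW n0).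
pose k := Num.truncn ((n%:R - a) / 2).
have /truncn_itv/andP[k1 k2] : 0 <= (n%:R - a) / 2 by rewrite divr_ge0//; lra.
rewrite -/k in k1 k2.
have kn : (k.*2 <= n)%N by rewrite -(ler_nat R) -mul2n natrM; lra.
have k0 : 0 < k.+1%:R :> R by rewrite ltr0n.
apply: (@le_trans _ _ (unif (walk n @^-1` [set (n%:R - 2 * k%:R)%R : R]))); last first.
  apply: le_measure; rewrite ?inE.
  - rewrite -[X in measurable X]setTI; exact: measurable_walk.
  - apply: measurable_set_le => //; exact: measurable_walk.
  - by move=> u /= ->; lra.
apply: le_trans (walk_binomial_ge n k); rewrite lee_fin.
apply: le_trans (bin_lower_bound R kn).
rewrite ler_pdivlMr ?ltr0n//.
apply: le_trans (ler_wpM2l (expR_ge0 _) n1N) _.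
rewrite -expRD ler_expR.
set t := (n%:R - 2 * k%:R) ^+ 2 / (2 * k.+1%:R).
suff : t <= 5 / 4 * N by move: t => t; lra.
rewrite /t.
rewrite ler_pdivrMr ?mulr_gt0//.
apply: (@le_trans _ _ ((a + 2) ^+ 2)).
  rewrite lerXn2r// ?nnegrE; first lra.
  - by rewrite addr_ge0//; lra.
  - by move: k2; rewrite -(natr1 k); lra.
apply: (@le_trans _ _ (5 / 4 * N * (n%:R - a))); last first.
  by rewrite ler_wpM2l ?mulr_ge0 ?(ltW N0)//; lra.
have aN : a * N <= n%:R * N / 50 by have := ler_wpM2r (ltW N0) an; lra.
have aa : 20 * a <= a ^+ 2 by rewrite expr2 ler_wpM2r//; lra.
have a20' : 400 <= a ^+ 2 by lra.
rewrite sqrrD; lra.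
Unshelve. all: by end_near. Qed.

(** * A stationary scale mixture of random walks *)

Definition expo (R : realType) : probability (measurableTypeR R) R.
Proof.
by refine (exponential_prob 1 : probability (measurableTypeR R) R); exact: ltr01.
Defined.

Lemma expo_tail_ge (R : realType) (t : R) : 0 < t ->
  ((expR (- t))%:E <= expo R `]t, +oo[%classic)%E.
Proof.
move=> t0.
have mI (i : interval R) : measurable ([set` i] : set (measurableTypeR R)) by exact: measurable_itv.
have N0 : expo R `]-oo, 0[%classic = 0%E.
  rewrite /expo/= /exponential_prob (eq_integral (cst 0%E)) ?integral0// => x.
  by rewrite inE/= in_itv/= => x0; rewrite lt0_exponential_pdf.
have C : expo R (~` `[0, t]%classic) = (expR (- t))%:E.
  rewrite probability_setC//= exponential_prob_itv0c// mulN1r.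
  change (1%:E - (1%:E - (expR (- t))%:E) = (expR (- t))%:E :> \bar R)%E.
  by rewrite -!EFinB; congr EFin; ring.
rewrite -C; apply: (@le_trans _ _ (expo R (`]-oo, 0[ `|` `]t, +oo[))).
  apply: le_measure; rewrite ?inE.
  - exact: measurableC.
  - exact: measurableU.
  - move=> x /=; rewrite !in_itv/= andbT => /negP; rewrite negb_and -!ltNge.
    by move=> /orP[]; [left|right].
apply: (le_trans (measureU2 _ _ _)) => //.
by rewrite /= in N0 *; rewrite N0 add0e.
Qed.

(** The exponential law has density exponential_pdf 1 by definition of its values
    on sets, and weights extend this from sets to functions. *)
Lemma integral_expo_le (R : realType) (W : R -> R) :
  measurable_fun [set: R] W -> (forall x, 0 <= W x) ->
  (\int[expo R]_x (W x)%:E <=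
   \int[lebesgue_measure]_x (exponential_pdf 1 x * W x)%:E)%E.
Proof.
move=> mW W0.
rewrite -(_ : (\int[expo R]_x (cst 1 x * W x)%R%:E = \int[expo R]_x (W x)%:E)%E); last first.
  by apply: eq_integral => x _; rewrite mul1r.
apply: (@le_integral_weight _ (measurableTypeR R) R (expo R) lebesgue_measure measurable) => //.
- exact: sigma_algebra_measurable.
- exact: measurable_exponential_pdf.
- by move=> x; rewrite exponential_pdf_ge0.
- move=> A mA; rewrite (eq_integral (cst 1%E))// integral_cst// mul1e.
  exact: lexx.
- by move=> B mB; rewrite -[X in measurable X]setTI; exact: mW.
Qed.

Arguments expo : simpl never.

Section example.
Context {R : realType}.
Variable alpha : R.
Hypothesis a01 : 0 < alpha < 1.

Let a0 : 0 < alpha. Proof. by have /andP[] := a01. Qed.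
Let a1 : 0 < 1 - alpha. Proof. by rewrite subr_gt0; have /andP[] := a01. Qed.

Let q : R := 2 * alpha / (1 - alpha).
Let q0 : 0 < q. Proof. by rewrite divr_gt0// mulr_gt0. Qed.

(** With xi exponential of parameter 1, the scale level xi satisfies
    P (level xi >= t) = exp (- 3/2 t^q).  The factor 3/2 has to exceed 1 for
    exp (level xi ^ q) to be integrable, and has to leave room below 3 for the
    cost of the random walk. *)
Definition level (x : R) : R := (2 / 3 * Num.max x 0) `^ q^-1.

Let level_ge0 x : 0 <= level x. Proof. exact: powR_ge0. Qed.

Lemma level_powR x : level x `^ q = 2 / 3 * Num.max x 0.
Proof.
rewrite /level -powRrM mulVf ?gt_eqF// powRr1// mulr_ge0//.
by rewrite le_max lexx orbT.
Qed.

Lemma measurable_level : measurable_fun [set: R] level.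
Proof.
apply: (measurableT_comp (measurable_powR _)) => //.
by apply: measurable_funM => //; exact: measurable_maxr.
Qed.

Let T : measurableType _ := (measurableTypeR R * measurableTypeR R)%type.

Let P : probability T R := (expo R \x @unif R)%E.

(** One random scale, shared by all times, multiplied by fair coins. *)
Definition Xhat (i : nat) (w : T) : R := level w.1 * coin i.-1 w.2.

Definition on_snd (f : R -> R) (w : T) : T := (w.1, f w.2).

Lemma measurable_on_snd (f : R -> R) : measurable_fun [set: R] f ->
  measurable_fun [set: T] (on_snd f).
Proof.
move=> mf; apply: measurable_fun_pair => //.
exact: measurableT_comp.
Qed.

Lemma on_snd_invariant (f : R -> R) :
  (forall B, measurable B -> unif (f @^-1` B) = unif B) ->
  forall A, measurable A -> P (on_snd f @^-1` A) = P A.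
Proof.
move=> fE A mA; rewrite /P/=; apply: (@eq_integral _ _ _ (expo R)) => x _ /=.
rewrite -[RHS]fE; last exact: measurable_xsection.
by congr (unif _); apply/seteqP; split=> y; rewrite /xsection/= !inE.
Qed.

(** The events that do not depend on the digits of rank i and above, encoded by
    invariance under flipping these digits.  The scale is known at time 0. *)
Definition Fhat (i : nat) : set (set T) :=
  [set A | measurable A /\ forall j, (i <= j)%N -> on_snd (flip j) @^-1` A = A].

Lemma filtration_Fhat : filtration Fhat.
Proof.
split.
- move=> i; split.
  + by split=> // j _; rewrite preimage_set0.
  + move=> A [mA Aj]; split; first exact: measurableD.
    by move=> j ij; rewrite setTD -preimage_setC Aj.
  + move=> A FA; split; first by apply: bigcup_measurable => k _; have [] := FA k.
    move=> j ij; rewrite preimage_bigcup; apply: eq_bigcup => // k _.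
    by have [_] := FA k; exact.
- by move=> i A [].
- by move=> i A [mA Aj]; split=> // j ij; apply: Aj; exact: ltnW.
Qed.

Lemma measurable_Xhat i : measurable_fun [set: T] (Xhat i).
Proof.
apply: measurable_funM; apply: measurableT_comp => //.
  exact: measurable_level.
exact: measurable_coin.
Qed.

Lemma adapted_Xhat i : (1 <= i)%N -> measurable_wrt (Fhat i) (Xhat i).
Proof.
move=> i1 B mB; split.
  by rewrite -[X in measurable X]setTI; exact: measurable_Xhat.
move=> j ij; apply/seteqP; split=> w; rewrite /preimage/= /Xhat/= coin_flip_lt//;
  by rewrite prednK.
Qed.

Lemma normr_Xhat_le i w : `|Xhat i w| <= level w.1.
Proof. by rewrite /Xhat normrM ger0_norm// ler_piMr// normr_coin_le1. Qed.

Lemma exp_moment_level : (\int[P]_w (expR (level w.1 `^ q))%:E < +oo)%E.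
Proof.
have mW : measurable_fun [set: R] (fun x => expR (level x `^ q)).
  apply: measurableT_comp => //; apply: (measurableT_comp (measurable_powR _)) => //.
  exact: measurable_level.
rewrite fubini_tonelli1; last 2 first.
- by apply/measurable_EFinP; exact: (measurableT_comp mW).
- by move=> w; rewrite lee_fin expR_ge0.
rewrite (_ : (\int[_]_x _ = \int[expo R]_x (expR (level x `^ q))%:E)%E); last first.
  apply: eq_integral => x _; rewrite /fubini_F/= integral_cst//=.
  rewrite [X in (_ * X)%E]probability_setT.
  by rewrite mule1.
apply: le_lt_trans (integral_expo_le mW (fun x => expR_ge0 _)) _.
have r3 : 0 <= 3^-1 :> R by [].
rewrite (_ : (\int[_]_x _ =
    \int[lebesgue_measure]_x (3%:E * (exponential_pdf 3^-1 x)%:E))%E); last first.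
  apply: eq_integral => x _; rewrite -EFinM; congr EFin; rewrite level_powR.
  have [x0|x0] := ltP x 0; first by rewrite !lt0_exponential_pdf// mul0r mulr0.
  rewrite !exponential_pdfE// mul1r mulrA divff// mul1r -expRD.
  by congr expR; field.
rewrite ge0_integralZl//=.
- by rewrite integral_exponential_pdf// mule1 ltry.
- by apply/measurable_EFinP; exact: measurable_exponential_pdf.
- by move=> x _; rewrite lee_fin exponential_pdf_ge0.
Qed.

Lemma exp_moment_Xhat i : (\int[P]_w (expR (`|Xhat i w| `^ q))%:E < +oo)%E.
Proof.
apply: le_lt_trans exp_moment_level; apply: ge0_le_integral => //.
- apply/measurable_EFinP; apply: measurableT_comp => //.
  apply: (measurableT_comp (measurable_powR _)) => //.
  by apply: measurableT_comp => //; exact: measurable_Xhat.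
- apply/measurable_EFinP; apply: measurableT_comp => //.
  apply: (measurableT_comp (measurable_powR _)) => //.
  by apply: measurableT_comp => //; exact: measurable_level.
- move=> w _; rewrite lee_fin ler_expR ge0_ler_powR ?nnegrE ?(ltW q0)//.
  exact: normr_Xhat_le.
Qed.

Lemma integrable_Xhat i : P.-integrable [set: T] (EFin \o Xhat i).
Proof.
apply/integrableP; split; first by apply/measurable_EFinP; exact: measurable_Xhat.
have [M M0 HM] := le_expR_powR (@ltr01 R) q0.
have mX := measurable_Xhat i.
have mE : measurable_fun [set: T] (fun w => expR (`|Xhat i w| `^ q)).
  apply: measurableT_comp => //; apply: (measurableT_comp (measurable_powR _)) => //.
  exact: measurableT_comp.
apply: (@le_lt_trans _ _ (\int[P]_w (M%:E * (expR (`|Xhat i w| `^ q))%:E))%E).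
  apply: ge0_le_integral => //.
  - by apply/measurable_EFinP; exact: measurableT_comp.
  - by apply: measurable_funeM; exact/measurable_EFinP.
  - by move=> w _ /=; rewrite -EFinM lee_fin; have := HM _ (normr_ge0 (Xhat i w)); rewrite mul1r.
rewrite ge0_integralZl//.
- by rewrite lte_mul_pinfty// ?lee_fin ?(ltW M0)//; exact: exp_moment_Xhat.
- exact/measurable_EFinP.
- by rewrite lee_fin ltW.
Qed.

(** Flipping the coin used at time i preserves the probability and the event A,
    and changes the sign of Xhat i: the integral is equal to its opposite. *)
Lemma integral_Xhat_eq0 i A : (1 <= i)%N -> Fhat i.-1 A ->
  (\int[P]_(w in A) (Xhat i w)%:E = 0)%E.
Proof.
move=> i1 [mA Aj]; have Ai := Aj _ (leqnn i.-1).
pose phi := on_snd (flip i.-1).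
have mphi : measurable_fun [set: T] phi by apply: measurable_on_snd; exact: measurable_flip.
have iA : P.-integrable A (EFin \o Xhat i) by exact: integrableS (integrable_Xhat i).
have XN : (EFin \o Xhat i) \o phi = (\- (EFin \o Xhat i))%E.
  by apply/funext => w /=; rewrite /Xhat/= coin_flip mulrN.
have : (\int[P]_(w in A) (Xhat i w)%:E = - \int[P]_(w in A) (Xhat i w)%:E)%E.
  transitivity (\int[pushforward P phi]_(w in A) (EFin \o Xhat i) w)%E.
    apply: eq_measure_integral => B mB _; rewrite /= /pushforward.
    by apply/esym/on_snd_invariant => // C mC; exact: unif_flip.
  rewrite integral_pushforward//.
  - rewrite Ai XN integralN//; exact: integrable_add_def.
  - by apply/measurable_EFinP; exact: measurable_Xhat.
  - by rewrite Ai XN; exact: integrableN.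
have fI : (\int[P]_(w in A) (Xhat i w)%:E)%E \is a fin_num.
  exact: integrable_fin_num iA.
rewrite -(fineK fI) -EFinN => -[]; set x := fine _ => xN.
by congr EFin; lra.
Qed.

Lemma martingale_Xhat : martingale_differences P Fhat Xhat.
Proof.
split.
  split; first exact: filtration_Fhat.
  by move=> i i1; split; [exact: integrable_Xhat|exact: adapted_Xhat].
move=> i i1; exists (cst 0%E); last exact: aeW.
have [sF _ _] := filtration_Fhat.
split; first by apply/measurable_wrtP => //; exact: measurable_cst.
by move=> A FA; rewrite integral0 [RHS]integral_Xhat_eq0.
Qed.

(** Xhat (h + i) is Xhat i composed with h shifts of the digits, a
    measure-preserving map. *)
Lemma stationary_Xhat : stationary P Xhat.
Proof.
move=> m h B mB.
have inv k A : measurable A -> unif (iter k shift @^-1` A) = unif (A : set R).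
  elim: k A => [//|k IH] A mA; rewrite -[RHS]unif_shift//.
  by apply: (IH (shift @^-1` A)); rewrite -[X in measurable X]setTI; exact: measurable_shift.
pose Z w := [tuple Xhat i.+1 w | i < m].
have mZ : measurable_fun [set: T] Z.
  apply/measurable_fun_tnthP => i; rewrite (_ : _ \o _ = Xhat i.+1); last first.
    by apply/funext => w /=; rewrite tnth_mktuple.
  exact: measurable_Xhat.
have mZB : measurable (Z @^-1` B) by rewrite -[X in measurable X]setTI; exact: mZ.
rewrite -[RHS](on_snd_invariant (inv h) mZB); congr (P _).
apply/seteqP; split=> w /=; rewrite /Z.
  move=> Bw; suff -> : [tuple Xhat i.+1 (on_snd (iter h shift) w) | i < m] =
    [tuple Xhat (h + i.+1) w | i < m] by [].
  apply: eq_from_tnth => i; rewrite !tnth_mktuple /Xhat/= /coin addnS/=.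
  by rewrite [in RHS]addnC iterD.
move=> Bw; suff <- : [tuple Xhat i.+1 (on_snd (iter h shift) w) | i < m] =
  [tuple Xhat (h + i.+1) w | i < m] by [].
apply: eq_from_tnth => i; rewrite !tnth_mktuple /Xhat/= /coin addnS/=.
by rewrite [in RHS]addnC iterD.
Qed.

Lemma partial_sum_Xhat n w : partial_sum Xhat n w = level w.1 * walk n w.2.
Proof. by rewrite /partial_sum big_add1/= /walk mulr_sumr. Qed.

(** The scale exceeds n^((1 - alpha) / 2) with probability exp (- 3/2 n^alpha), and
    independently the walk exceeds n^((1 + alpha) / 2) with at least this
    probability; the product of the two thresholds is n. *)
Lemma Xhat_lower_bound : \forall n \near \oo,
  ((expR (- (3 * n%:R `^ alpha)))%:E
   <= P [set w | (n%:R <= max_partial_sum Xhat n w)%R])%E.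
Proof.
near=> n.
have n1 : (1 <= n)%N by near: n; exact: nbhs_infty_ge.
have n0 : 0 < n%:R :> R by rewrite ltr0n.
have := expo_tail_ge.
have wlb : ((expR (- (3 / 2 * n%:R `^ alpha)))%:E <=
    unif [set u : R | (n%:R `^ ((1 + alpha) / 2) <= walk n u)%R])%E.
  by near: n; exact: walk_tail_lower_bound.
set N := n%:R `^ alpha in wlb *.
have N0 : 0 < N by rewrite powR_gt0.
move=> /(_ R (3 / 2 * N)); rewrite mulr_gt0// => /(_ isT) elb.
set U := [set u : R | _] in wlb.
have mU : measurable U by apply: measurable_set_le => //; exact: measurable_walk.
have -> : - (3 * N) = - (3 / 2 * N) - (3 / 2 * N) by field.
rewrite expRD EFinM.
apply: (@le_trans _ _ (P (`]3 / 2 * N, +oo[ `*` U))).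
  rewrite /P/= product_measure1E//.
  by apply: lee_pmul => //; rewrite lee_fin expR_ge0.
apply: le_measure; rewrite ?inE.
- exact: measurableX.
- apply: measurable_set_le => //; apply: measurable_max_partial_sum => i _.
  exact: measurable_Xhat.
- move=> [x u] [/=]; rewrite in_itv/= andbT => xN uU.
  apply: (@le_trans _ _ (partial_sum Xhat n (x, u))); last first.
    rewrite /max_partial_sum; set S := fun k => partial_sum Xhat k (x, u).
    by apply: (@le_bigmax_seq _ _ _ _ _ n xpredT S) => //; rewrite mem_index_iota n1/=.
  rewrite partial_sum_Xhat/=.
  have -> : n%:R = n%:R `^ ((1 - alpha) / 2) * n%:R `^ ((1 + alpha) / 2) :> R.
    rewrite -powRD; last by rewrite (gt_eqF n0) implybT.
    rewrite (_ : (1 - alpha) / 2 + (1 + alpha) / 2 = 1); last by field.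
    by rewrite powRr1 ?ltW.
  apply: ler_pM; rewrite ?powR_ge0//.
  have -> : n%:R `^ ((1 - alpha) / 2) = N `^ q^-1.
    rewrite /N -powRrM; congr (_ `^ _); rewrite /q; field.
    by rewrite !gt_eqF.
  rewrite ge0_ler_powR ?nnegrE ?invr_ge0 ?(ltW q0) ?(ltW N0)//.
    by rewrite mulr_ge0// le_max lexx orbT.
  have x0 : 0 < x by apply: lt_trans xN; rewrite mulr_gt0.
  by rewrite max_l ?ltW//; lra.
Unshelve. all: by end_near. Qed.
End example.

(** * The three assertions together *)

Theorem corollary2p1 (R : realType) :
  (forall (alpha C1 C2 : R), 0 < alpha < 1 -> 0 < C1 -> 0 < C2 ->
   forall (d : measure_display) (T : measurableType d) (P : probability T R)
     (F : nat -> set (set T)) (X : nat -> T -> R) (Q : nat -> T -> \bar R),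
   supermartingale_differences P F X ->
   is_quadratic_characteristic P F X Q ->
   exponential_moments P X Q alpha C1 C2 ->
   forall (x : R) (n : nat), 0 < x -> (1 <= n)%N ->
   (P [set w | (n%:R * x <= max_partial_sum X n w)%R]
    <= (expR (- (x `^ (1 + alpha) / (2 * (1 + 3^-1 * x)) * n%:R `^ alpha))
        + (n%:R * C1 + C2) * expR (- (x `^ alpha * n%:R `^ alpha)))%:E)%E)
  /\
  (exists C : R, 0 < C /\
   forall (alpha C1 C2 : R), 0 < alpha < 1 -> 0 < C1 -> 0 < C2 ->
   exists K : R, 0 < K /\
   forall (d : measure_display) (T : measurableType d) (P : probability T R)
     (F : nat -> set (set T)) (X : nat -> T -> R) (Q : nat -> T -> \bar R),
   supermartingale_differences P F X ->
   is_quadratic_characteristic P F X Q ->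
   exponential_moments P X Q alpha C1 C2 ->
   bigO_with K (fun n => fine (P [set w | (n%:R <= max_partial_sum X n w)%R]))
               (fun n => expR (- (C * n%:R `^ alpha))))
  /\
  (forall alpha : R, 0 < alpha < 1 ->
   exists (d : measure_display) (T : measurableType d) (P : probability T R)
     (F : nat -> set (set T)) (X : nat -> T -> R),
   [/\ martingale_differences P F X,
       stationary P X,
       ('E_P[fun w => expR (`|X 1%N w| `^ (2 * alpha / (1 - alpha)))%R] < +oo)%E
     & \forall n \near \oo,
         ((expR (- (3 * n%:R `^ alpha)))%:E
          <= P [set w | (n%:R <= max_partial_sum X n w)%R])%E]).
Proof.
split; [|split].
- move=> alpha C1 C2 a01 _ _ d T P F X Q smX qQ momX x n x0 n1.
  exact: supermartingale_upper_bound a01 smX qQ momX x n x0 n1.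
- exists (3 / 8); split; first by rewrite divr_gt0.
  by move=> alpha C1 C2 a01 C10 C20; exact: supermartingale_bigO.
- move=> alpha a01.
  exists _, _, (expo R \x @unif R)%E, (@Fhat R), (Xhat alpha); split.
  + exact: martingale_Xhat.
  + exact: stationary_Xhat.
  + by rewrite unlock; exact: exp_moment_Xhat.
  + exact: Xhat_lower_bound.
Qed.
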